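(* Suppose that $X$ is integrable and nonconstant, and that $P_j(t)\ge0$ and $\sum_{j\ge1}P_j(t)=1$ almost surely. Set $$S_t=\sum_{j\ge1}P_j(t)X_j,\qquad P_*(t)=\sup_{j\ge1}P_j(t),\qquad\mu=\mathbb{E}X.$$ The following are equivalent as $t\to\star$: (1) $S_t$ converges in distribution to a constant; (2) $P_*(t)\to0$ in probability; (3) for one, and hence for every, $p>1$, $\mathbb{E}\sum_{j\ge1}P_j(t)^p\to0$. Whenever these conditions hold, the constant is $\mu$ and $S_t\to\mu$ in probability.
   Context: $t$ ranges over $(0,\infty)$ and $t\to\star$ means either $t\downarrow0$ or $t\to\infty$ (one fixed choice). For each $t$, $P(t)=(P_j(t))_{j\ge1}$ is a random sequence of weights. $X,X_1,X_2,\ldots$ are iid real random variables, independent of the weights. *)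

(* Defs.v *)
From HB Require Import structures.
From mathcomp Require Import all_boot all_order all_algebra finmap.
From mathcomp Require Import all_classical all_reals all_analysis.
From mathcomp Require Import measurable_realfun random_variable.

Set Implicit Arguments.
Unset Strict Implicit.
Unset Printing Implicit Defensive.

Import Order.TTheory GRing.Theory Num.Theory.
Import numFieldNormedType.Exports.

Local Open Scope classical_set_scope.
Local Open Scope ring_scope.

Section independence.
Context d (T : measurableType d) (R : realType) (Pr : probability T R).

(* The product rule over every finite subfamily. *)
Definition mutually_independent (I : choiceType) (X : I -> {RV Pr >-> R}) :=
  forall (J : {fset I}) (A : I -> set R), (forall i, measurable (A i)) ->
    Pr (\bigcap_(i in [set` J]) X i @^-1` A i) =
    (\prod_(i <- J) Pr (X i @^-1` A i))%E.

(* Restricted to measurable sets: [distribution Pr (X i)] is also a (junk)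
   set function outside the Borel sets. *)
Definition identically_distributed (I : Type) (X : I -> {RV Pr >-> R}) :=
  forall (i j : I) (A : set R), measurable A ->
    distribution Pr (X i) A = distribution Pr (X j) A.

Definition iid (I : choiceType) (X : I -> {RV Pr >-> R}) :=
  mutually_independent X /\ identically_distributed X.

Definition sigma_generated (I : Type) (X : I -> {RV Pr >-> R}) :
    set_system T :=
  <<s \bigcup_i preimage_set_system setT (X i) measurable >>.

Definition independent_families (I K : Type)
    (X : I -> {RV Pr >-> R}) (Y : K -> {RV Pr >-> R}) :=
  forall A B, sigma_generated X A -> sigma_generated Y B ->
    Pr (A `&` B) = (Pr A * Pr B)%E.

End independence.

Section convergence.
Context d (T : measurableType d) (R : realType) (Pr : probability T R).
Context (I : Type).

Definition cvg_in_distribution (F : set_system I) (Y : I -> {RV Pr >-> R})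
    (Z : {RV Pr >-> R}) :=
  forall x : R, {for x, continuous (cdf Z)} ->
    cdf (Y t) x @[t --> F] --> cdf Z x.

Definition cvg_in_distribution_cst (F : set_system I)
    (Y : I -> {RV Pr >-> R}) (c : R) :=
  cvg_in_distribution F Y (cst c : {mfun T >-> R}).

Definition cvg_in_probability (F : set_system I) (Y : I -> {RV Pr >-> R})
    (c : R) :=
  forall e : R, 0 < e -> Pr [set w | e < `|Y t w - c|] @[t --> F] --> 0%E.

End convergence.

Section weighted_sum.
Context d (T : measurableType d) (R : realType).
Implicit Types P X : nat -> {mfun T >-> R}.

(* Equal to an arbitrary fixed real at the points where the series diverges. *)
Definition weighted_sum P X (w : T) : R :=
  limn (series (fun j => P j w * X j w)).

Lemma measurable_fun_limn (h : nat -> T -> R) :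
  (forall n, measurable_fun setT (h n)) ->
  measurable_fun setT (fun w => limn (h ^~ w)).
Proof.
move=> mh.
pose g n (w : T) : \bar R := (h n w)%:E.
have mg n : measurable_fun setT (g n) by exact/measurable_EFinP.
pose s (w : T) : \bar R := limn_esup (g ^~ w).
pose i (w : T) : \bar R := limn_einf (g ^~ w).
have ms : measurable_fun setT s by exact: measurable_fun_limn_esup.
have mi : measurable_fun setT i.
  apply: measurableT_comp => //; apply: measurable_fun_limn_esup => n.
  exact: measurableT_comp.
have hE w : limn (h ^~ w) =
    if (s w \is a fin_num) && (s w == i w) then fine (s w) else point.
  case: ifPn => [/andP[sfin /eqP si]|].
    apply/cvg_lim => //.
    have gs : g ^~ w @ \oo --> s w.
      have inf_sup : cvgn (g ^~ w).
        apply/cvg_ex; exists (s w).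
        apply: (@squeeze_cvge _ _ _ _ (einfs (g ^~ w)) (g ^~ w)
          (esups (g ^~ w))).
        - apply: nearW => n; apply/andP; split.
            by apply: ereal_inf_lbound; exists n => /=.
          by apply: ereal_sup_ubound; exists n => /=.
        - by rewrite si /i limn_einf_lim; exact: is_cvg_einfs.
        - by rewrite /s limn_esup_lim; exact: is_cvg_esups.
      by rewrite /s is_cvg_limn_esupE.
    by apply: (@fine_cvg _ _ _ _ (g ^~ w)); rewrite fineK.
  move=> nfin; apply: dvgP => /cvg_ex[l hl]; move/negP: nfin; apply.
  have gl : g ^~ w @ \oo --> l%:E by apply: cvg_EFin hl; exact: nearW.
  by have := cvg_limn_einf_sup gl; rewrite /s /i => -[-> ->]; rewrite eqxx.
rewrite (_ : (fun w => _) = (fun w =>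
    if (s w \is a fin_num) && (s w == i w) then fine (s w) else point)); last first.
  exact/funext.
apply: measurable_fun_ifT => //; last exact: measurableT_comp.
apply: measurable_and.
  apply: (measurable_fun_bool true); rewrite setTI.
  by have := emeasurable_fin_num measurableT ms; rewrite setTI.
exact: measurable_fun_eqe.
Qed.

Lemma measurable_weighted_sum P X : measurable_fun setT (weighted_sum P X).
Proof.
apply: measurable_fun_limn => n; rewrite /series /=.
by apply: measurable_sum => j; exact: measurable_funM.
Qed.

HB.instance Definition _ P X :=
  isMeasurableFun.Build _ _ _ _ (weighted_sum P X) (measurable_weighted_sum P X).

(* [sup] is real-valued, with value 0 on unbounded sequences. *)
Definition max_weight P (w : T) : R := sup (range (fun j => P j w)).

Lemma measurable_max_weight P : measurable_fun setT (max_weight P).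
Proof.
pose s (w : T) : \bar R := ereal_sup [set (P j w)%:E | j in [set: nat]].
have ms : measurable_fun setT s.
  have -> : s = fun w => esups (fun j => (P j w)%:E) 0.
    by apply/funext => w; congr ereal_sup; apply/seteqP; split => _ [j _ <-];
      exists j.
  by apply: measurable_fun_esups => n; exact/measurable_EFinP.
rewrite (_ : max_weight P = fine \o s); first exact: measurableT_comp.
apply/funext => w /=; have imE : [set (P j w)%:E | j in [set: nat]] =
    EFin @` range (fun j => P j w) by rewrite image_comp.
have ne : range (fun j => P j w) !=set0 by exists (P 0 w), 0%N.
rewrite /s imE /max_weight.
have [ub|nub] := pselect (has_ubound (range (fun j => P j w))).
  by rewrite ereal_sup_EFin.
rewrite sup_out; last by case.
suff -> : ereal_sup (EFin @` range (fun j => P j w)) = +oo%E by [].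
case E : (ereal_sup _) => [r| |] //.
- exfalso; apply: nub; exists r => x Px; rewrite -lee_fin -E.
  by apply: ereal_sup_ubound; exists x.
- have : ((P 0 w)%:E <= -oo)%E.
    by rewrite -E; apply: ereal_sup_ubound; exists (P 0 w) => //; exists 0%N.
  by rewrite leeNy_eq.
Qed.

HB.instance Definition _ P :=
  isMeasurableFun.Build _ _ _ _ (max_weight P) (measurable_max_weight P).

End weighted_sum.

(* Main.v *)
Require Import Defs.
From HB Require Import structures.
From mathcomp Require Import all_boot all_order all_algebra finmap.
From mathcomp Require Import all_classical all_reals all_analysis.
From mathcomp Require Import measurable_realfun random_variable.
From mathcomp Require Import ring lra.

Set Implicit Arguments.
Unset Strict Implicit.
Unset Printing Implicit Defensive.

Import Order.TTheory GRing.Theory Num.Theory.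
Import numFieldNormedType.Exports.

Local Open Scope classical_set_scope.
Local Open Scope ring_scope.

(* Independence disintegrates the law of [S_t] over the weights: with [S_p] the
   sum for a deterministic weight sequence [p],
     P(|S_t - c| > e) = E[ P(|S_p - c| > e) at p = P(t) ],
   so two bounds for deterministic weights, integrated over [P(t)], suffice.
   - Lower bound: replacing the J-th summand by an independent copy [X] keeps
     the law of [S_p] and moves it by at least [p_J (b - a)] on the event
     [X_J <= a < b <= X], which has a fixed positive probability when [X] is
     nonconstant. Hence if [p_J (b - a) > 2 e] then [S_p] is at distance more
     than [e] from any constant with probability bounded below.
   - Upper bound: clip the [X_j] at level [M]; the clipped and centred part has
     second moment at most [4 M^2 sup p], and the remainder has mean absolute
     value at most [E |X - clip M X|], which vanishes as [M] grows.
   The moments are compared with the maximal weight through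
     [P_*^p <= \sum_j P_j^p <= P_*^(p-1)]. *)

(** * Real sequences with the product sigma-algebra *)

Section sequence_space.
Context (R : realType).

Definition coordinate_sets : set_system (nat -> R) :=
  \bigcup_i preimage_set_system setT (fun x => x i) measurable.

Local Notation sequence_space := (g_sigma_algebraType coordinate_sets).

Definition coordinate i (x : sequence_space) : R := x i.

Lemma measurable_coordinate i : measurable_fun setT (coordinate i).
Proof. by move=> _ A mA; apply: sub_sigma_algebra; exists i => //; exists A. Qed.

HB.instance Definition _ i := isMeasurableFun.Build _ _ _ _
  (coordinate i) (measurable_coordinate i).

Lemma measurable_fun_sequence_space d (T : measurableType d)
    (f : T -> sequence_space) :
  (forall i, measurable_fun setT (f ^~ i)) -> measurable_fun setT f.
Proof.
move=> mf.
refine (@measurability _ _ T sequence_space setT f coordinate_sets erefl _).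
by move=> _ [B] [i _] [A mA <-] <-; have := mf i measurableT A mA; rewrite !setTI.
Qed.

(** The family [A] is total, but only its first [n] sets impose a constraint. These events form a
    generating pi-system on which the product rule can be evaluated. *)
Definition cylinder : set_system (nat -> R) :=
  [set C | exists n (A : nat -> set R), (forall i, measurable (A i)) /\
    C = [set x | forall i, (i < n)%N -> A i (x i)]].

Lemma cylinder_measurable : cylinder `<=` @measurable _ sequence_space.
Proof.
move=> _ [n [A [mA ->]]].
rewrite [X in measurable X](_ : _ =
    \bigcap_(i in `I_n) ((coordinate i) @^-1` A i)); last first.
  by apply/seteqP; split => x /= H i; exact: H.
apply: bigcap_measurableType => i _; rewrite -[X in measurable X]setTI.
exact: measurable_coordinate.
Qed.

Lemma cylinder_setI : setI_closed cylinder.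
Proof.
move=> _ _ [m [A [mA ->]]] [n [B [mB ->]]].
(* Beyond its own length each cylinder imposes nothing, hence the padding by [setT]. *)
exists (maxn m n), (fun i => (if (i < m)%N then A i else setT) `&`
  (if (i < n)%N then B i else setT)); split.
  by move=> i; apply: measurableI; case: ifP.
apply/seteqP; split => x /=.
  by move=> [xA xB] i _; split; case: ifPn => // H; [exact: xA|exact: xB].
move=> H; split => i im.
  by have := H i; rewrite leq_max im => /(_ erefl)[].
by have := H i; rewrite leq_max im orbT => /(_ erefl)[].
Qed.

Lemma cylinder_generates : @measurable _ sequence_space = <<s cylinder >>.
Proof.
apply/seteqP; split; apply: smallest_sub => //.
- move=> _ [i _ [A mA <-]]; apply: sub_sigma_algebra.
  exists i.+1, (fun j => if j == i then A else setT); split.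
    by move=> j; case: ifP.
  rewrite setTI; apply/seteqP; split => x /=.
    by move=> Ax j _; case: eqP => // ->.
  by move=> /(_ i (ltnSn _)); rewrite eqxx.
- exact: sigma_algebra_measurable.
- exact: cylinder_measurable.
Qed.

(** Uniqueness on a generating pi-system; finiteness of the total mass allows the constant cover by
    the whole space. *)
Lemma sequence_space_measure_unique
    (m1 m2 : {measure set sequence_space -> \bar R}) :
  (m1 setT < +oo)%E -> (forall C, cylinder C -> m1 C = m2 C) ->
  forall A, measurable A -> m1 A = m2 A.
Proof.
move=> m1T m12 A; rewrite cylinder_generates.
have cT (i : nat) : cylinder setT.
  by exists 0%N, (fun=> setT); split => //; exact/seteqP.
have cover : \bigcup_(k in [set: nat]) [set: sequence_space] = setT.
  exact: bigcup_const.
exact: (@g_sigma_algebra_measure_unique _ R sequence_space _ cylinder_measurable _ cT cover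
  _ _ cylinder_setI m12 (fun=> m1T)).
Qed.

End sequence_space.

Notation sequence_space R := (g_sigma_algebraType (@coordinate_sets R)).

(** * Laws of iid sequences and disintegration under independence *)

Section law.
Context d (T : measurableType d) (R : realType) (Pr : probability T R).

(** The product over a finite set of indices is rewritten along the enumeration [k]. Equality of
    laws moves every factor to the reference index [i0], so the value does not depend on [k]. *)
Lemma iid_cylinder (I : choiceType) (Y : I -> {RV Pr >-> R}) (i0 : I)
    (k : nat -> I) (n : nat) (A : nat -> set R) :
  iid Y -> injective k -> (forall i, measurable (A i)) ->
  Pr [set w | forall i, (i < n)%N -> A i (Y (k i) w)] =
  (\prod_(i < n) Pr (Y i0 @^-1` A i))%E.
Proof.
move=> [Yi Yid] kinj mA.
(* [k'] is a left inverse of [k]; it turns the sets [A], numbered by position, into a family indexed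
   by [I]. *)
pose k' (x : I) := if pselect (exists i, k i = x) is left e
  then projT1 (cid e) else 0%N.
have kK i : k' (k i) = i.
  rewrite /k'; case: pselect => [e|[]]; last by exists i.
  by apply: kinj; exact: projT2 (cid e).
pose J := [fset k i | i in iota 0 n]%fset.
have := Yi J (A \o k') (fun i => mA _).
rewrite (perm_big _ (enum_imfset _ _))/=; last by move=> ? ? _ _; exact: kinj.
rewrite big_map undup_id ?iota_uniq// => E.
rewrite (_ : [set w | _] = \bigcap_(i in [set` J]) Y i @^-1` (A \o k') i).
  rewrite E -[n in iota 0 n]subn0 big_mkord; apply: eq_bigr => i _.
  by rewrite kK; exact: Yid.
apply/seteqP; split => w /=.
  move=> H x /imfsetP[i /=]; rewrite mem_iota add0n => /andP[_ ni] ->.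
  by rewrite kK; exact: H.
move=> H i ni; have /= := H (k i); rewrite kK; apply.
by apply/imfsetP; exists i => //=; rewrite mem_iota.
Qed.

Definition sequence_of (Y : nat -> {RV Pr >-> R}) (w : T) : sequence_space R :=
  fun i => Y i w.

Lemma measurable_sequence_of Y : measurable_fun setT (sequence_of Y).
Proof. by apply: measurable_fun_sequence_space => i; exact: measurable_funPT. Qed.

HB.instance Definition _ Y := isMeasurableFun.Build _ _ _ _
  (sequence_of Y) (measurable_sequence_of Y).

(** Both laws give every cylinder the same product of one-dimensional probabilities, and cylinders
    determine the law. *)
Lemma iid_sequence_law (I : choiceType) (Y : I -> {RV Pr >-> R})
    (k l : nat -> I) (B : set (sequence_space R)) :
  iid Y -> injective k -> injective l -> measurable B ->
  Pr (sequence_of (Y \o k) @^-1` B) = Pr (sequence_of (Y \o l) @^-1` B).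
Proof.
move=> iidY kinj linj mB.
apply: (@sequence_space_measure_unique R (distribution Pr (sequence_of (Y \o k)))
  (distribution Pr (sequence_of (Y \o l)))) => //.
  exact: (le_lt_trans (probability_le1 Pr (measurableT : measurable setT)) (ltry 1)).
move=> _ [n [A [mA ->]]].
exact: etrans (iid_cylinder (k 0%N) n iidY kinj mA)
  (esym (iid_cylinder (k 0%N) n iidY linj mA)).
Qed.

(** Independence makes the joint law of the two sequences the product of their laws, and the product
    measure of [B] is the integral of the measures of its sections. *)
Lemma independent_families_disintegration (K : Type) (Z : K -> {RV Pr >-> R})
    (g : nat -> K) (P : nat -> {RV Pr >-> R})
    (B : set (sequence_space R * sequence_space R)) :
  independent_families Z P -> measurable B ->
  let F w := Pr [set w' | B (sequence_of P w, sequence_of (Z \o g) w')] in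
  measurable_fun setT F /\
  Pr [set w | B (sequence_of P w, sequence_of (Z \o g) w)] = (\int[Pr]_w F w)%E.
Proof.
move=> ZP mB F.
pose U := sequence_of P; pose V := sequence_of (Z \o g).
pose lV := distribution Pr V; pose lU := distribution Pr U.
have FE : F = (lV \o xsection B) \o U.
  by apply/funext => w; rewrite /F /= /lV /distribution /pushforward; congr (Pr _);
    apply/seteqP; split => w' /=; rewrite /xsection /= inE.
have mxs := @measurable_fun_xsection _ _ _ _ _ lV _ mB.
split; first by rewrite FE; apply: measurableT_comp.
pose W w := (U w, V w).
have mW : measurable_fun setT W.
  by apply/measurable_fun_pairP; split; exact: measurable_funPT.
pose W' : {mfun T >-> (sequence_space R * sequence_space R)%type} :=
  HB.pack W (isMeasurableFun.Build _ _ _ _ W mW).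
transitivity (distribution Pr W' B) => //.
rewrite -(@product_measure_unique _ _ _ _ _ lU lV (distribution Pr W'))//.
  rewrite /product_measure1 ge0_integral_distribution//.
  by rewrite FE.
move=> A C mA mC; rewrite /lU /lV /distribution /pushforward /=.
rewrite muleC -ZP.
- by congr (Pr _); apply/seteqP; split => w /= [].
(* Every coordinate of [V] belongs to the family [Z], so preimages under [V] lie in the
   sigma-algebra generated by [Z], where independence applies. *)
- have mV : @measurable_fun _ _ (g_sigma_algebraType (\bigcup_i
      preimage_set_system setT (Z i) measurable)) _ setT V.
    apply: measurable_fun_sequence_space => i _ E mE.
    by apply: sub_sigma_algebra; exists (g i) => //; exists E.
  by have := mV measurableT C mC; rewrite setTI.
- have mU : @measurable_fun _ _ (g_sigma_algebraType (\bigcup_i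
      preimage_set_system setT (P i) measurable)) _ setT U.
    apply: measurable_fun_sequence_space => i _ E mE.
    by apply: sub_sigma_algebra; exists i => //; exists E.
  by have := mU measurableT A mA; rewrite setTI.
Qed.

End law.

(** * Products of independent variables and sums of orthogonal variables *)

Section independence_theory.
Context d (T : measurableType d) (R : realType) (Pr : probability T R).

Lemma mutually_independent_pair (I : choiceType) (Y : I -> {RV Pr >-> R})
    (i j : I) (A B : set R) :
  mutually_independent Y -> i != j -> measurable A -> measurable B ->
  Pr (Y i @^-1` A `&` Y j @^-1` B) = (Pr (Y i @^-1` A) * Pr (Y j @^-1` B))%E.
Proof.
move=> Yi ij mA mB.
have := Yi [fset i; j]%fset (fun k => if k == i then A else B).
rewrite big_fsetU1 ?inE//= big_seq_fset1 eqxx eq_sym (negbTE ij) => <-.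
  congr (Pr _); apply/seteqP; split => w /=.
    move=> [Aw Bw] k /=; rewrite !inE => /orP[] /eqP ->.
      by rewrite eqxx.
    by rewrite eq_sym (negbTE ij).
  move=> H; split.
    by have := H i; rewrite /= !inE !eqxx => /(_ erefl).
  by have := H j; rewrite /= !inE eqxx orbT eq_sym (negbTE ij) => /(_ erefl).
by move=> k; case: ifP.
Qed.

(** A class stable under sums, products and precomposition with measurable maps, and integrable
    under every probability; it settles all integrability conditions of the second-moment
    computation. *)
Definition bounded_measurable d' (T' : measurableType d') (f : T' -> R) :=
  measurable_fun setT f /\ exists C : R, forall w, `|f w| <= C.

Lemma bounded_measurable_integrable d' (T' : measurableType d')
    (Q : probability T' R) (f : T' -> R) :
  bounded_measurable f -> Q.-integrable setT (EFin \o f).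
Proof.
move=> [mf [C fC]]; apply: measurable_bounded_integrable => //.
  exact: (le_lt_trans (probability_le1 Q (measurableT : measurable setT)) (ltry 1)).
exists C; split; first exact: num_real.
by move=> r Cr w _ /=; exact: le_trans (fC w) (ltW Cr).
Qed.

Lemma bounded_measurableD d' (T' : measurableType d') (f g : T' -> R) :
  bounded_measurable f -> bounded_measurable g -> bounded_measurable (f \+ g).
Proof.
move=> [mf [C fC]] [mg [D gD]]; split; first exact: measurable_funD.
by exists (C + D) => w; rewrite (le_trans (ler_normD _ _))// lerD.
Qed.

Lemma bounded_measurableM d' (T' : measurableType d') (f g : T' -> R) :
  bounded_measurable f -> bounded_measurable g -> bounded_measurable (f \* g).
Proof.
move=> [mf [C fC]] [mg [D gD]]; split; first exact: measurable_funM.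
by exists (C * D) => w; rewrite normrM ler_pM.
Qed.

Lemma bounded_measurable_cst d' (T' : measurableType d') (c : R) :
  bounded_measurable (cst c : T' -> R).
Proof. by split => //; exists `|c|. Qed.

Lemma bounded_measurable_comp d' (T' : measurableType d') d'' (T'' : measurableType d'')
    (f : T' -> R) (h : T'' -> T') :
  bounded_measurable f -> measurable_fun setT h -> bounded_measurable (f \o h).
Proof.
move=> [mf [C fC]] mh; split; first exact: measurableT_comp.
by exists C => w; exact: fC.
Qed.

(** The pair has the product of the two laws as its law, and Fubini factors the integral. *)
Lemma independent_Rintegral_mul (I : choiceType) (Y : I -> {RV Pr >-> R})
    (i j : I) (f g : R -> R) :
  mutually_independent Y -> i != j ->
  bounded_measurable f -> bounded_measurable g ->
  (\int[Pr]_w (f (Y i w) * g (Y j w)) =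
   (\int[Pr]_w f (Y i w)) * \int[Pr]_w g (Y j w))%R.
Proof.
move=> Yi ij bf bg.
pose W w := (Y i w, Y j w).
have mW : measurable_fun setT W.
  by apply/measurable_fun_pairP; split; exact: measurable_funPT.
pose W' : {mfun T >-> (R * R)%type} :=
  HB.pack W (isMeasurableFun.Build _ _ _ _ W mW).
pose lU := distribution Pr (Y i); pose lV := distribution Pr (Y j).
have lW : forall A, measurable A -> (lU \x lV)%E A = distribution Pr W' A.
  apply: product_measure_unique => A B mA mB.
  exact: mutually_independent_pair.
pose h (z : R * R) := f z.1 * g z.2.
have bh : bounded_measurable h.
  by apply: bounded_measurableM; apply: bounded_measurable_comp.
have bhW : bounded_measurable (h \o W) by exact: bounded_measurable_comp.
have ih := bounded_measurable_integrable (lU \x lV)%E bh.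
have bfY : bounded_measurable (f \o Y i) by exact: bounded_measurable_comp.
have bgY : bounded_measurable (g \o Y j) by exact: bounded_measurable_comp.
have ifY := bounded_measurable_integrable Pr bfY.
have igY := bounded_measurable_integrable Pr bgY.
rewrite /Rintegral.
have -> : (\int[Pr]_w (f (Y i w) * g (Y j w))%:E =
    \int[distribution Pr W']_z (h z)%:E)%E.
  rewrite integral_distribution//; first by case: bh => ? _; exact/measurable_EFinP.
  have H := bounded_measurable_integrable Pr bhW; exact H.
rewrite (@eq_measure_integral _ _ _ _ (lU \x lV)%E); last first.
  by move=> A mA _; exact: esym (lW A mA).
rewrite -integral12_prod_meas1//=.
have mf : measurable_fun setT (EFin \o f) by apply/measurable_EFinP; case: bf.
have mg : measurable_fun setT (EFin \o g) by apply/measurable_EFinP; case: bg.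
have ifU := bounded_measurable_integrable (distribution Pr (Y i)) bf.
have igV := bounded_measurable_integrable (distribution Pr (Y j)) bg.
under eq_integral => x _.
  rewrite /fubini_F /h /=.
  under eq_integral do rewrite EFinM.
  rewrite integralZl//.
  rewrite integral_distribution//=.
  over.
have igf : (\int[Pr]_w (g (Y j w))%:E)%E \is a fin_num.
  exact: integrable_fin_num igY.
rewrite /= -(fineK igf).
rewrite integralZr//.
rewrite integral_distribution//= fineM//.
exact: integrable_fin_num ifY.
Qed.

(** Pythagoras: the cross terms vanish by orthogonality, and each diagonal term is bounded through
    [|Z j| <= C]. *)
Lemma Rintegral_sqr_sum_le (Z : nat -> T -> R) (p : nat -> R) (C : R) :
  (forall j, bounded_measurable (Z j)) -> (forall j w, `|Z j w| <= C) ->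
  (forall i j, i != j -> \int[Pr]_w (Z i w * Z j w) = 0)%R ->
  forall n, (\int[Pr]_w (\sum_(j < n) p j * Z j w) ^+ 2 <=
             \sum_(j < n) p j ^+ 2 * C ^+ 2)%R.
Proof.
move=> bZ ZC Z0; pose A n w := \sum_(j < n) p j * Z j w.
have AS n : A n.+1 = A n \+ (fun w => p n * Z n w).
  by apply/funext => w; rewrite /A big_ord_recr.
have bpZ j : bounded_measurable (fun w => p j * Z j w).
  by apply: bounded_measurableM => //; exact: bounded_measurable_cst.
have bA n : bounded_measurable (A n).
  elim: n => [|n IH]; last by rewrite AS; exact: bounded_measurableD.
  rewrite (_ : A 0%N = cst 0); first exact: bounded_measurable_cst.
  by apply/funext => w; rewrite /A big_ord0.
have int f : bounded_measurable f -> Pr.-integrable setT (EFin \o f).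
  exact: bounded_measurable_integrable.
(* A partial sum is orthogonal to every variable not yet included in it; this removes the cross term
   from the induction step below. *)
have AZ n k : (n <= k)%N -> (\int[Pr]_w (A n w * Z k w) = 0)%R.
  elim: n => [|n IH] nk.
    rewrite /Rintegral integral0_eq// => w _.
    by rewrite /A big_ord0 mul0r.
  under eq_Rintegral do rewrite AS /= mulrDl.
  rewrite RintegralD//; last 2 first.
    by apply: int; exact: bounded_measurableM.
    by apply: int; exact: bounded_measurableM.
  rewrite IH ?add0r; last exact: ltnW.
  under eq_Rintegral do rewrite -mulrA.
  rewrite RintegralZl//; last by apply: int; exact: bounded_measurableM.
  by rewrite Z0 ?mulr0// ltn_eqF.
elim=> [|n IH].
  rewrite big_ord0 /Rintegral integral0_eq// => w _.
  by rewrite big_ord0 expr0n.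
rewrite big_ord_recr/=.
under eq_Rintegral do rewrite -/(A n.+1 _) AS /= sqrrD.
have bAZ : bounded_measurable (fun w => A n w * (p n * Z n w)).
  exact: bounded_measurableM.
have bA2 : bounded_measurable (fun w => A n w ^+ 2).
  exact: bounded_measurableM (bA n) (bA n).
have bZ2 : bounded_measurable (fun w => (p n * Z n w) ^+ 2).
  exact: bounded_measurableM (bpZ n) (bpZ n).
have bAZ2 : bounded_measurable (fun w => (A n w * (p n * Z n w)) *+ 2).
  exact: (bounded_measurableD bAZ bAZ).
rewrite RintegralD//; last 2 first.
  by apply: int; exact: bounded_measurableD.
  exact: int.
rewrite RintegralD//; [|exact: int..].
rewrite [X in _ + X + _ <= _](_ : _ = 0) ?addr0; last first.
  under eq_Rintegral do rewrite -mulr_natl [A n _ * _]mulrCA mulrA.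
  rewrite RintegralZl//; last by apply: int; exact: bounded_measurableM.
  by rewrite AZ// mulr0.
apply: lerD; first exact: IH.
apply: (@le_trans _ _ (\int[Pr]_w cst (p n ^+ 2 * C ^+ 2) w)%R).
  apply: le_Rintegral => //; [exact: int|exact: int (bounded_measurable_cst _ _)|].
  move=> w _ /=; rewrite exprMn ler_wpM2l ?sqr_ge0//.
  by rewrite -[leLHS]real_normK ?num_real// lerXn2r// ?nnegrE// (le_trans _ (ZC n w)).
by rewrite /= Rintegral_cst// [X in fine X]probability_setT/= mulr1.
Qed.

End independence_theory.

(** * Deterministic weights, weighted series and clipping *)

Section series_facts.
Context (R : realType).
Implicit Types (u p : nat -> R).

Lemma nneseries_EFin_cvg u : (forall j, 0 <= u j) ->
  (\sum_(j <oo) (u j)%:E < +oo)%E ->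
  series u @ \oo --> fine (\sum_(j <oo) (u j)%:E)%E.
Proof.
move=> u0 uoo.
have -> : series u = fine \o (fun n => (\sum_(0 <= k < n) (u k)%:E)%E).
  by apply/funext => n /=; rewrite sumEFin.
apply: fine_cvg; rewrite fineK; last first.
  by rewrite ge0_fin_numE// nneseries_ge0// => n _ _; rewrite lee_fin.
by apply: is_cvg_nneseries => n _ _; rewrite lee_fin.
Qed.

Lemma limn_einf_le (v : nat -> \bar R) (b : \bar R) :
  (forall n, (v n <= b)%E) -> (limn_einf v <= b)%E.
Proof.
move=> vb; rewrite limn_einf_lim; apply: lime_le; first exact: is_cvg_einfs.
apply: nearW => n; apply: le_trans (vb n).
by apply: ereal_inf_lbound; exists n => /=.
Qed.

Definition is_weights p :=
  (forall j, 0 <= p j) /\ (\sum_(j <oo) (p j)%:E = 1)%E.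

Lemma weights_partial_sum_le1 p n : is_weights p -> \sum_(j < n) p j <= 1.
Proof.
move=> [p0 p1]; rewrite -lee_fin -p1 -sumEFin -(big_mkord xpredT (EFin \o p)).
by apply: nneseries_lim_ge => k _ _; rewrite lee_fin.
Qed.

Lemma weights_le1 p j : is_weights p -> p j <= 1.
Proof.
move=> wp; have := weights_partial_sum_le1 j.+1 wp; apply: le_trans.
by rewrite big_ord_recr/= lerDr sumr_ge0// => i _; case: wp.
Qed.

Lemma weights_ubound p : is_weights p -> has_ubound (range p).
Proof. by move=> wp; exists 1 => _ [j _ <-]; exact: weights_le1. Qed.

Lemma weights_le_sup p j : is_weights p -> p j <= sup (range p).
Proof. by move=> wp; apply: ub_le_sup; [exact: weights_ubound|exists j]. Qed.

Lemma weights_sup_ge0 p : is_weights p -> 0 <= sup (range p).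
Proof. by move=> wp; apply: le_trans (weights_le_sup 0%N wp); case: wp. Qed.

Lemma weights_sup_le1 p : is_weights p -> sup (range p) <= 1.
Proof.
move=> wp; apply: ge_sup; first by exists (p 0%N), 0%N.
by move=> _ [j _ <-]; exact: weights_le1.
Qed.

Lemma weights_lt_sup p e : is_weights p -> e < sup (range p) ->
  exists j, e < p j.
Proof.
move=> wp /sup_gt[]; first by exists (p 0%N), 0%N.
by move=> _ [j _ <-] ej; exists j.
Qed.

Lemma weights_series_cvg p : is_weights p -> series p @ \oo --> (1 : R).
Proof.
move=> [p0 p1]; have := nneseries_EFin_cvg p0; rewrite p1; apply.
exact: ltry.
Qed.

(** One factor of each square is bounded by the supremum, and the remaining factors sum to at most
    1. *)
Lemma weights_sqr_sum_le p n : is_weights p ->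
  \sum_(j < n) p j ^+ 2 <= sup (range p).
Proof.
move=> wp; apply: (@le_trans _ _ (\sum_(j < n) sup (range p) * p j)).
  apply: ler_sum => j _; rewrite expr2 ler_wpM2r ?weights_le_sup//.
  by case: wp.
rewrite -mulr_sumr -[leRHS]mulr1 ler_wpM2l ?weights_sup_ge0//.
exact: weights_partial_sum_le1.
Qed.

Lemma weighted_series_cvg p (x : nat -> R) : is_weights p ->
  (\sum_(j <oo) (p j * `|x j|)%:E < +oo)%E ->
  cvgn [normed series (fun j => p j * x j)].
Proof.
move=> [p0 _] xoo.
rewrite (_ : [normed series _] = series (fun j => p j * `|x j|)).
  by apply/cvg_ex; eexists; apply: nneseries_EFin_cvg => // j; rewrite mulr_ge0.
by congr series; apply/funext => j /=; rewrite normrM ger0_norm.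
Qed.

Lemma weighted_series_norm_le p (x : nat -> R) : is_weights p ->
  (\sum_(j <oo) (p j * `|x j|)%:E < +oo)%E ->
  (`|limn (series (fun j => p j * x j))|%:E <=
    \sum_(j <oo) (p j * `|x j|)%:E)%E.
Proof.
move=> wp xoo; have pc := weighted_series_cvg wp xoo.
have [p0 _] := wp.
have u0 j : 0 <= p j * `|x j| by rewrite mulr_ge0.
rewrite -[leRHS]fineK; last first.
  by rewrite ge0_fin_numE// nneseries_ge0// => n _ _; rewrite lee_fin.
rewrite lee_fin (le_trans (lim_series_norm pc))//.
rewrite (_ : [normed series _] = series (fun j => p j * `|x j|)).
  by have /cvg_lim -> := nneseries_EFin_cvg u0 xoo.
by congr series; apply/funext => j /=; rewrite normrM ger0_norm.
Qed.

(** For [0 <= M], the projection of [x] onto the interval [[-M, M]]. *)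
Definition clip (M x : R) : R := Num.max (- M) (Num.min x M).

Lemma clip_norm_le M x : 0 <= M -> `|clip M x| <= M.
Proof.
move=> M0; rewrite ler_norml /clip le_max lexx/= ge_max ge_min lexx orbT andbT.
by rewrite (le_trans _ M0)// oppr_le0.
Qed.

Lemma clip_id M x : `|x| <= M -> clip M x = x.
Proof. by rewrite ler_norml => /andP[? ?]; rewrite /clip min_l// max_r. Qed.

Lemma sub_clip_norm_le M x : 0 <= M -> `|x - clip M x| <= `|x|.
Proof.
move=> M0; have [xM|Mx] := leP `|x| M; first by rewrite clip_id// subrr normr0.
have [x0|x0] := leP 0 x.
  rewrite ger0_norm// in Mx; rewrite /clip min_r; last exact: ltW.
  by rewrite max_r; last lra; rewrite !ger0_norm; lra.
rewrite ltr0_norm// in Mx; rewrite /clip min_l; last lra.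
by rewrite max_l; last lra; rewrite !ler0_norm; lra.
Qed.

Lemma measurable_clip M : measurable_fun setT (clip M).
Proof. by apply: measurable_maxr => //; exact: measurable_minr. Qed.

End series_facts.

(** * Fixed weights: almost sure convergence and the lower bound *)

Section fixed_weights.
Context d (T : measurableType d) (R : realType) (Pr : probability T R).

Lemma identically_distributed_ge0_integral (I : Type) (Y : I -> {RV Pr >-> R})
    (i j : I) (g : R -> \bar R) :
  identically_distributed Y -> measurable_fun setT g ->
  (forall x, 0 <= g x)%E ->
  (\int[Pr]_w g (Y i w) = \int[Pr]_w g (Y j w))%E.
Proof.
move=> Yid mg g0.
have -> : (\int[Pr]_w g (Y i w) = \int[distribution Pr (Y i)]_x g x)%E.
  by rewrite ge0_integral_distribution.
have -> : (\int[Pr]_w g (Y j w) = \int[distribution Pr (Y j)]_x g x)%E.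
  by rewrite ge0_integral_distribution.
by apply: eq_measure_integral => A mA _; exact: Yid.
Qed.

Lemma identically_distributed_Rintegral (I : Type) (Y : I -> {RV Pr >-> R})
    (i j : I) (g : R -> R) :
  identically_distributed Y -> bounded_measurable g ->
  (\int[Pr]_w g (Y i w) = \int[Pr]_w g (Y j w))%R.
Proof.
move=> Yid bg.
have E k : (\int[Pr]_w g (Y k w) = \int[distribution Pr (Y k)]_x g x)%R.
  rewrite /Rintegral integral_distribution//.
    by case: bg => mg _; exact/measurable_EFinP.
  have bgY : bounded_measurable (g \o Y k) by exact: bounded_measurable_comp.
  have H := bounded_measurable_integrable Pr bgY; exact H.
rewrite !E /Rintegral; congr fine.
by apply: eq_measure_integral => A mA _; exact: Yid.
Qed.

Section weighted_integral.
Variables (p : nat -> R) (f : nat -> T -> R) (a : R).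
Hypotheses (wp : is_weights p) (mf : forall j, measurable_fun setT (f j)).
Hypotheses (f0 : forall j w, 0 <= f j w)
  (fa : forall j, (\int[Pr]_w (f j w)%:E = a%:E)%E).

Lemma measurable_weighted_nneseries :
  measurable_fun setT (fun w => \sum_(j <oo) (p j * f j w)%:E)%E.
Proof.
apply: ge0_emeasurable_sum => j.
  by move=> w _ _; rewrite lee_fin mulr_ge0//; case: wp.
by move=> _; apply/measurable_EFinP; exact: measurable_funM.
Qed.

(** Tonelli exchanges sum and integral; the weights then sum to 1. *)
Lemma integral_weighted_nneseries :
  (\int[Pr]_w \sum_(j <oo) (p j * f j w)%:E = a%:E)%E.
Proof.
have [p0 p1] := wp.
rewrite integral_nneseries//; last 2 first.
- by move=> j; apply/measurable_EFinP; exact: measurable_funM.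
- by move=> j w _; rewrite lee_fin mulr_ge0.
transitivity (\sum_(j <oo) (a%:E * (p j)%:E))%E.
  apply: eq_eseriesr => j _; under eq_integral do rewrite EFinM.
  rewrite ge0_integralZl//; first by rewrite fa muleC.
  - exact/measurable_EFinP.
  - by move=> w _; rewrite lee_fin.
  - by rewrite lee_fin.
by rewrite nneseriesZl// ?p1 ?mule1// => j _; rewrite lee_fin.
Qed.

Lemma weighted_nneseries_fin_ae :
  {ae Pr, forall w, \sum_(j <oo) (p j * f j w)%:E < +oo}%E.
Proof.
have p0 := wp.1.
have s0 w : (0 <= \sum_(j <oo) (p j * f j w)%:E)%E.
  by apply: nneseries_ge0 => j _ _; rewrite lee_fin mulr_ge0.
have int : Pr.-integrable setT (fun w => \sum_(j <oo) (p j * f j w)%:E)%E.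
  apply/integrableP; split; first exact: measurable_weighted_nneseries.
  under eq_integral do rewrite gee0_abs//.
  by rewrite integral_weighted_nneseries ltry.
have := integrable_ae measurableT int; apply: filterS => w /(_ I).
by rewrite ge0_fin_numE.
Qed.

End weighted_integral.

Variables (X : {RV Pr >-> R}) (Xs : nat -> {RV Pr >-> R}).
Hypotheses (iidX : iid (oapp Xs X)) (X_int : Pr.-integrable setT (EFin \o X)).

Let cst_mfun (p : nat -> R) : nat -> {mfun T >-> R} := fun j => cst (p j).

(** The weighted sum of the [|Xs j|] has the finite mean [E|X|]. Hence the series defining the
    weighted sum converges absolutely outside a null set. *)
Lemma weighted_abs_fin_ae p : is_weights p ->
  {ae Pr, forall w, \sum_(j <oo) (p j * `|Xs j w|)%:E < +oo}%E.
Proof.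
move=> wp; apply: (@weighted_nneseries_fin_ae _ _ (fine (\int[Pr]_w `|X w|%:E)%E)) => //.
- by move=> j; exact: measurableT_comp.
- move=> j; rewrite fineK.
    apply: (identically_distributed_ge0_integral (Some j) None
      (g := fun x => `|x|%:E) iidX.2) => //.
    by apply/measurable_EFinP; exact: normr_measurable.
  rewrite ge0_fin_numE; last by apply: integral_ge0 => w _; rewrite lee_fin.
  by case/integrableP : X_int.
Qed.

Section lower_bound.
Variables (p : nat -> R) (c e : R).
Hypothesis wp : is_weights p.

Let far : set (sequence_space R) :=
  [set x | e < `|limn (series (fun j => p j * x j)) - c|].

Let measurable_far : measurable far.
Proof.
pose S := weighted_sum (fun j => cst (p j) : {mfun sequence_space R >-> R})
  (fun j => @coordinate R j).
have : measurable_fun setT (fun x => e < `|S x - c|).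
  apply: measurable_fun_ltr => //; apply: measurableT_comp => //.
  by apply: measurable_funB => //; exact: measurable_weighted_sum.
by move=> /(_ measurableT [set true]); rewrite setTI; exact.
Qed.

(** The two series differ by a series whose only possibly nonzero term is at index [J]. *)
Lemma replace_coordinate_cvg (x : nat -> R) (J : nat) (y : R) :
  cvgn (series (fun j => p j * x j)) ->
  limn (series (fun j => p j * (if j == J then y else x j))) =
  limn (series (fun j => p j * x j)) + p J * (y - x J).
Proof.
move=> cx; apply/cvg_lim => //.
pose z j := if j == J then p J * (y - x J) else 0.
rewrite (_ : (fun j => _) = (fun j => p j * x j) \+ z); last first.
  apply/funext => j; rewrite /z /=; case: eqP => [->|_]; last by rewrite addr0.
  by rewrite -mulrDr addrCA subrr addr0.
rewrite seriesD; apply: cvgD => //.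
apply: cvg_near_cst; exists J.+1 => // n /= Jn.
rewrite /series/= big_mkord (bigD1 (Ordinal Jn))//= /z eqxx big1 ?addr0//.
by move=> i; rewrite -val_eqE/= => /negbTE ->.
Qed.

(* Replacing [Xs J] by the extra copy [X] preserves the law of the sum and
   moves it by at least [p J * (b - a)] on the event [Xs J <= a, b <= X]. *)
Lemma fixed_weights_lower_bound (a b : R) (J : nat) : a < b ->
  2 * e < p J * (b - a) ->
  (Pr [set w | X w <= a]%R * Pr [set w | b <= X w]%R <=
   2%:E * Pr [set w | e < `|weighted_sum (cst_mfun p) Xs w - c|]%R)%E.
Proof.
move=> ab eJ.
(* [k] enumerates the summands, and [l] does the same with the spare copy [X], of index [None], in
   place of [Xs J]. Both are injective, so the two sequences have the same law. *)
pose k (i : nat) := Some i.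
pose l (i : nat) := if i == J then None else Some i.
have kinj : injective k by move=> i j [].
have linj : injective l.
  by rewrite /l => i j; case: eqP => [->|_]; case: eqP => [->|_] // [].
pose Y := oapp Xs X.
have mk : measurable (sequence_of (Y \o k) @^-1` far) by exact: measurable_funPTI.
have ml : measurable (sequence_of (Y \o l) @^-1` far) by exact: measurable_funPTI.
have Pl : Pr (sequence_of (Y \o l) @^-1` far) =
          Pr (sequence_of (Y \o k) @^-1` far) by exact: iid_sequence_law.
have -> : [set w | e < `|weighted_sum (cst_mfun p) Xs w - c|] =
    sequence_of (Y \o k) @^-1` far by [].
have [N [mN N0 NP]] := weighted_abs_fin_ae wp.
have -> : Pr [set w | X w <= a] = Pr (Xs J @^-1` `]-oo, a]).
  have := iidX.2 None (Some J) `]-oo, a]%classic (measurable_itv _).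
  rewrite /distribution /pushforward /= => <-.
  by congr (Pr _); apply/seteqP; split => w /=; rewrite in_itv.
have -> : [set w | b <= X w] = X @^-1` `[b, +oo[.
  by apply/seteqP; split => w /=; rewrite in_itv/= andbT.
have <- : (Pr (Xs J @^-1` `]-oo, a] `&` X @^-1` `[b, +oo[) =
    Pr (Xs J @^-1` `]-oo, a]) * Pr (X @^-1` `[b, +oo[))%E.
  exact: (mutually_independent_pair iidX.1 (i := Some J) (j := None)).
(* The right side becomes [Pr N], which is zero, plus the probabilities of [far] along [l] and along
   [k], ready for a union bound. *)
rewrite mule_natl mule2n -[X in (_ <= X + _)%E]Pl -[leRHS]add0e -{1}N0 [leRHS]addeA.
have mE : measurable (Xs J @^-1` `]-oo, a] `&` X @^-1` `[b, +oo[).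
  by apply: measurableI; exact: measurable_funPTI.
apply: (@le_trans _ _ (Pr ((N `|` sequence_of (Y \o l) @^-1` far) `|`
    sequence_of (Y \o k) @^-1` far))); last first.
  apply: (le_trans (measureU2 _ _ _)) => //; first exact: measurableU.
  by apply: leeD => //; exact: measureU2.
apply: le_measure; rewrite ?inE//; first by do 2 apply: measurableU => //.
move=> w /= []; rewrite !in_itv/= andbT => wa wb.
have [Nw|Nw] := pselect (N w); first by left; left.
have fin : (\sum_(j <oo) (p j * `|Xs j w|)%:E < +oo)%E.
  by apply: contrapT => H; apply: Nw; exact: NP.
have cw : cvgn (series (fun j => p j * Xs j w)).
  by apply: normed_cvg; exact: weighted_series_cvg.
have := replace_coordinate_cvg J (X w) cw.
rewrite (_ : (fun j => _) = (fun j => p j * sequence_of (Y \o l) w j)); last first.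
  by apply/funext => j; rewrite /sequence_of /= /l; case: eqP.
(* If both sums were within [e] of [c], they would differ by at most [2 * e], against [eJ]. *)
move=> El; have [H|H] := ltP e `|limn (series (fun j => p j * Xs j w)) - c|.
  by right.
left; right; rewrite /far /= El ltNge; apply/negP => H'.
have : p J * (b - a) <= p J * (X w - Xs J w).
  by rewrite ler_wpM2l//; [exact: wp.1|lra].
move: H H' eJ; rewrite !ler_norml => /andP[? ?] /andP[? ?] ? ?; lra.
Qed.

End lower_bound.

End fixed_weights.

(** * Fixed weights: the upper bound by clipping *)

Section upper_bound.
Context d (T : measurableType d) (R : realType) (Pr : probability T R).
Variables (X : {RV Pr >-> R}) (Xs : nat -> {RV Pr >-> R}).
Hypotheses (iidX : iid (oapp Xs X)) (X_int : Pr.-integrable setT (EFin \o X)).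

Definition clip_error (M : R) : R := \int[Pr]_w `|X w - clip M (X w)|.

Lemma clip_error_integrable M : 0 <= M ->
  Pr.-integrable setT (fun w => (X w - clip M (X w))%:E).
Proof.
move=> M0; apply: (le_integrable _ _ _ X_int) => //.
  apply/measurable_EFinP; apply: measurable_funB => //.
  by apply: measurableT_comp => //; exact: measurable_clip.
by move=> w _ /=; rewrite lee_fin sub_clip_norm_le.
Qed.

Lemma clip_errorE M : 0 <= M ->
  (\int[Pr]_w `|X w - clip M (X w)|%:E = (clip_error M)%:E)%E.
Proof.
move=> M0; rewrite /clip_error /Rintegral fineK//.
have := integrable_abse (clip_error_integrable M0).
by move=> /(integrable_fin_num measurableT).
Qed.

Lemma clip_error_ge0 M : 0 <= clip_error M.
Proof. exact: Rintegral_ge0. Qed.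

(** Dominated convergence with bound [|X|]; at each point the integrand vanishes as soon as [n]
    reaches [|X w|]. *)
Lemma clip_error_cvg0 : clip_error n%:R @[n --> \oo] --> 0.
Proof.
pose f n w := `|X w - clip n%:R (X w)|%:E.
have mf n : measurable_fun setT (f n).
  apply/measurable_EFinP; apply: measurableT_comp => //.
  apply: measurable_funB => //.
  by apply: measurableT_comp => //; exact: measurable_clip.
have [||||_ _] := @dominated_convergence _ _ _ Pr _ measurableT f (cst 0%E)
    (fun w => `|X w|%:E) mf.
- exact: measurable_cst.
- apply: aeW => w _; apply: cvg_near_cst.
  near=> n; rewrite /f clip_id ?subrr ?normr0//.
  near: n; exact: nbhs_infty_ger.
- have := integrable_abse X_int; exact.
- apply: aeW => w n _; rewrite /f /= normr_id lee_fin.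
  exact: sub_clip_norm_le.
rewrite integral0 => H.
by apply: (fine_cvg (f := fun n => (\int[Pr]_w f n w)%E)).
Unshelve. all: by end_near. Qed.

Variable p : nat -> R.
Hypothesis wp : is_weights p.

(** The centred clipped variables are orthogonal and bounded by [2 * M], so each partial sum has
    second moment at most [(2 * M) ^+ 2] times the maximal weight. Fatou carries the bound to the
    limit. *)
Lemma fixed_weights_sqr_bound (M : R) (m := \int[Pr]_w clip M (X w)) : 0 <= M ->
  (\int[Pr]_w (limn (series (fun j => p j * (clip M (Xs j w) - m))) ^+ 2)%:E <=
   (4 * M ^+ 2 * sup (range p))%:E)%E.
Proof.
move=> M0.
have bc : bounded_measurable (clip M).
  by split; [exact: measurable_clip|exists M => x; exact: clip_norm_le].
have bcX (Y : {RV Pr >-> R}) : bounded_measurable (clip M \o Y).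
  exact: bounded_measurable_comp.
have mE j : \int[Pr]_w clip M (Xs j w) = m.
  exact: (identically_distributed_Rintegral (Some j) None iidX.2 bc).
have mM : `|m| <= M.
  apply: le_trans (le_normr_Rintegral _ _) _ => //.
    exact: (bounded_measurable_integrable Pr (bcX X)).
  apply: (@le_trans _ _ (\int[Pr]_w cst M w)%R).
    apply: le_Rintegral => //.
    - have /integrable_abse := bounded_measurable_integrable Pr (bcX X); exact.
    - exact: (bounded_measurable_integrable Pr (bounded_measurable_cst _ _)).
    - by move=> w _; exact: clip_norm_le.
  by rewrite /= Rintegral_cst// [X in fine X]probability_setT/= mulr1.
pose g x := clip M x - m.
have bg : bounded_measurable g.
  exact: (bounded_measurableD bc (bounded_measurable_cst _ (- m))).
have gM x : `|g x| <= 2 * M.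
  rewrite /g (le_trans (ler_normB _ _))// mulr2n mulrDl mul1r lerD//.
  exact: clip_norm_le.
have bZ j : bounded_measurable (fun w => g (Xs j w)).
  exact: bounded_measurable_comp.
have Z0 j : \int[Pr]_w g (Xs j w) = 0.
  rewrite /g RintegralB//.
  - by rewrite mE Rintegral_cst// [X in fine X]probability_setT/= mulr1 subrr.
  - exact: (bounded_measurable_integrable Pr (bcX (Xs j))).
  - exact: (bounded_measurable_integrable Pr (bounded_measurable_cst _ _)).
have orth i j : i != j -> \int[Pr]_w (g (Xs i w) * g (Xs j w)) = 0.
  move=> ij; have := @independent_Rintegral_mul _ _ _ Pr _ _ (Some i) (Some j)
    g g iidX.1 _ bg bg => /= ->; first by rewrite Z0 mul0r.
  by apply: contra_neq ij => -[].
pose A n w := \sum_(j < n) p j * g (Xs j w).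
have A2 n : (\int[Pr]_w (A n w ^+ 2)%:E <= (4 * M ^+ 2 * sup (range p))%:E)%E.
  have bA : bounded_measurable (A n).
    elim: n => [|n IH].
      rewrite (_ : A 0%N = cst 0); first exact: bounded_measurable_cst.
      by apply/funext => w; rewrite /A big_ord0.
    rewrite (_ : A n.+1 = A n \+ (cst (p n) \* (fun w => g (Xs n w)))).
      apply: bounded_measurableD => //; apply: bounded_measurableM => //.
      exact: bounded_measurable_cst.
    by apply/funext => w; rewrite /A big_ord_recr.
  have iA : Pr.-integrable setT (EFin \o (fun w => A n w ^+ 2)).
    have H := bounded_measurable_integrable Pr (bounded_measurableM bA bA).
    exact H.
  rewrite -[leLHS]fineK; last exact: (integrable_fin_num measurableT iA).
  rewrite lee_fin.
  apply: le_trans (Rintegral_sqr_sum_le p bZ (fun j w => gM _) orth n) _.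
  rewrite -mulr_suml exprMn mulrC -natrX ler_wpM2l ?mulr_ge0 ?sqr_ge0//.
  exact: weights_sqr_sum_le.
(* The terms are dominated by [2 * M * p j], so the series converges at every point and the square
   of its sum is the lower limit of the squared partial sums. *)
apply: (@le_trans _ _ (\int[Pr]_w limn_einf (fun n => (A n w ^+ 2)%:E))%E).
  rewrite le_eqVlt; apply/orP; left; apply/eqP.
  apply: eq_integral => w _.
  have cA : cvgn (series (fun j => p j * g (Xs j w))).
    apply: normed_cvg; apply: weighted_series_cvg => //.
    apply: (@le_lt_trans _ _ (\sum_(j <oo) ((2 * M)%:E * (p j)%:E))%E).
      apply: lee_nneseries => [j _ _|j _].
        by rewrite lee_fin mulr_ge0//; exact: wp.1.
      by rewrite -EFinM lee_fin mulrC ler_wpM2r//; exact: wp.1.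
    rewrite nneseriesZl; last by move=> j _; rewrite lee_fin; exact: wp.1.
    by rewrite wp.2 mule1 ltry.
  have : (A n w ^+ 2)%:E @[n --> \oo] -->
      (limn (series (fun j => p j * g (Xs j w))) ^+ 2)%:E.
    apply: cvg_EFin; first exact: nearW.
    rewrite (_ : _ \o _ = (fun n => series (fun j => p j * g (Xs j w)) n ^+ 2)).
      by apply: cvgM.
    by apply/funext => n /=; rewrite /A /series/= big_mkord.
  by move=> /cvg_limn_einf_sup[].
apply: le_trans (limn_einf_le A2).
apply: fatou => // n.
  apply/measurable_EFinP; rewrite /A.
  apply: measurable_funX; apply: measurable_sum => j.
  by apply: measurable_funM => //; case: (bZ j).
by move=> w _; rewrite lee_fin sqr_ge0.
Qed.

(* Clip at level [M]: the clipped part is treated by Chebyshev, the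
   remainder by Markov. *)
Lemma fixed_weights_upper_bound (M e : R) : 0 <= M -> 0 < e ->
  (Pr [set w | e < `|weighted_sum (fun j => cst (p j) : {mfun T >-> R}) Xs w -
                     fine 'E_Pr[X]%E|]%R <=
   (16 * M ^+ 2 / e ^+ 2 * sup (range p) + 4 / e * clip_error M)%:E)%E.
Proof.
move=> M0 e0.
set S := weighted_sum _ Xs.
have bc : bounded_measurable (clip M).
  by split; [exact: measurable_clip|exists M => x; exact: clip_norm_le].
pose m := \int[Pr]_w clip M (X w); pose mu := fine 'E_Pr[X]%E.
have mmu : `|m - mu| <= clip_error M.
  have -> : m - mu = - \int[Pr]_w (X w - clip M (X w)).
    rewrite RintegralB//; last first.
      have bcX : bounded_measurable (clip M \o X) by exact: bounded_measurable_comp.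
      exact: (bounded_measurable_integrable Pr bcX).
    by rewrite opprB /mu unlock.
  by rewrite normrN; apply: le_normr_Rintegral => //; exact: clip_error_integrable.
pose A w := limn (series (fun j => p j * (clip M (Xs j w) - m))).
pose D j w := `|Xs j w - clip M (Xs j w)|.
have mXc j : measurable_fun setT (fun w => Xs j w - clip M (Xs j w)).
  apply: measurable_funB => //.
  by apply: measurableT_comp => //; exact: measurable_clip.
have mD j : measurable_fun setT (D j) by exact: measurableT_comp.
have D0 j w : 0 <= D j w by exact: normr_ge0.
have DE j : (\int[Pr]_w (D j w)%:E = (clip_error M)%:E)%E.
  rewrite -clip_errorE//.
  apply: (identically_distributed_ge0_integral (Some j) None
    (g := fun x => `|x - clip M x|%:E) iidX.2) => //.
  apply/measurable_EFinP; apply: measurableT_comp => //.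
  by apply: measurable_funB => //; exact: measurable_clip.
(* [B] collects the clipping remainder and the shift of the mean from [mu] to [m]. Its integral is
   twice the clip error, so Markov at level [e / 2] yields the factor [4 / e]. *)
pose B w := (\sum_(j <oo) (p j * D j w)%:E + (clip_error M)%:E)%E.
have B0 w : (0 <= B w)%E.
  rewrite adde_ge0// ?lee_fin ?clip_error_ge0//; apply: nneseries_ge0 => j _ _.
  by rewrite lee_fin mulr_ge0//; exact: wp.1.
have mB : measurable_fun setT B.
  by apply: emeasurable_funD => //; exact: measurable_weighted_nneseries.
have mA : measurable_fun setT A.
  apply: measurable_fun_limn => n; rewrite /series/=.
  apply: measurable_sum => j; apply: measurable_funM => //.
  apply: measurable_funB => //.
  by apply: measurableT_comp => //; exact: measurable_clip.
have mA2 : measurable_fun setT (fun w => (A w ^+ 2)%:E).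
  by apply/measurable_EFinP; exact: measurable_funX.
(* The event [e / 2 <= |A w|], squared so that Markov's inequality becomes Chebyshev's; [4 * M ^+ 2]
   over [(e / 2) ^+ 2] gives the constant 16. *)
pose EA := [set w | ((e / 2) ^+ 2)%:E <= `|(A w ^+ 2)%:E|]%E.
pose EB := [set w | (e / 2)%:E <= `|B w|]%E.
have mEA : measurable EA.
  have := emeasurable_fun_c_infty measurableT
    (measurableT_comp (@abse_measurable R setT) mA2) ((e / 2) ^+ 2)%:E.
  by rewrite setTI.
have mEB : measurable EB.
  have := emeasurable_fun_c_infty measurableT
    (measurableT_comp (@abse_measurable R setT) mB) (e / 2)%:E.
  by rewrite setTI.
have PA : (Pr EA <= (16 * M ^+ 2 / e ^+ 2 * sup (range p))%:E)%E.
  have e20 : 0 < (e / 2) ^+ 2 by rewrite exprn_gt0// divr_gt0.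
  have := le_integral_abse Pr measurableT mA2 e20; rewrite setTI -/EA => H.
  rewrite -(@lee_pmul2l _ ((e / 2) ^+ 2)%:E)//.
  apply: (le_trans H).
  under eq_integral do rewrite gee0_abs ?lee_fin ?sqr_ge0//.
  apply: (le_trans (fixed_weights_sqr_bound M0)).
  rewrite -EFinM lee_fin le_eqVlt; apply/orP; left; apply/eqP.
  by field; rewrite gt_eqF.
have PB : (Pr EB <= (4 / e * clip_error M)%:E)%E.
  have e20 : 0 < e / 2 by rewrite divr_gt0.
  have := le_integral_abse Pr measurableT mB e20; rewrite setTI -/EB => H.
  rewrite -(@lee_pmul2l _ (e / 2)%:E)//.
  apply: (le_trans H).
  under eq_integral do rewrite gee0_abs//.
  rewrite ge0_integralD//; last 3 first.
  - move=> w _; apply: nneseries_ge0 => j _ _.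
    by rewrite lee_fin mulr_ge0//; exact: wp.1.
  - exact: measurable_weighted_nneseries.
  - by move=> w _; rewrite lee_fin clip_error_ge0.
  rewrite (integral_weighted_nneseries wp mD D0 DE).
  rewrite integral_cst// [X in (_ * X)%E]probability_setT mule1.
  rewrite -EFinD -EFinM lee_fin le_eqVlt; apply/orP; left; apply/eqP.
  by field; rewrite gt_eqF.
have [N [mN N0 NP]] := weighted_abs_fin_ae iidX X_int wp.
apply: (@le_trans _ _ (Pr ((N `|` EA) `|` EB))); last first.
  apply: (le_trans (measureU2 _ _ _)) => //; first exact: measurableU.
  rewrite EFinD; apply: leeD => //.
  apply: (le_trans (measureU2 _ _ _)) => //.
  by rewrite [X in (X + _)%E]N0 add0e.
apply: le_measure; rewrite ?inE//.
- have : measurable_fun setT (fun w => e < `|S w - mu|).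
    apply: measurable_fun_ltr => //; apply: measurableT_comp => //.
    exact: measurable_funB.
  by move=> /(_ measurableT [set true]); rewrite setTI; exact.
- by do 2 apply: measurableU => //.
move=> w /= eS.
have [Nw|Nw] := pselect (N w); first by left; left.
have fin : (\sum_(j <oo) (p j * `|Xs j w|)%:E < +oo)%E.
  by apply: contrapT => H; apply: Nw; exact: NP.
have finD : (\sum_(j <oo) (p j * D j w)%:E < +oo)%E.
  apply: le_lt_trans fin; apply: lee_nneseries => [j _ _|j _].
    by rewrite lee_fin mulr_ge0//; exact: wp.1.
  by rewrite lee_fin ler_wpM2l ?sub_clip_norm_le//; exact: wp.1.
have cX : cvgn (series (fun j => p j * Xs j w)).
  by apply: normed_cvg; exact: weighted_series_cvg.
have cD : cvgn (series (fun j => p j * (Xs j w - clip M (Xs j w)))).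
  by apply: normed_cvg; exact: weighted_series_cvg.
(* Since the weights sum to 1, subtracting [m] from every clipped summand subtracts exactly [m] from
   the sum. *)
have AE : A w = S w - m - limn (series (fun j => p j * (Xs j w - clip M (Xs j w)))).
  rewrite /A; apply/cvg_lim => //.
  rewrite (_ : (fun j => _) = (fun j => p j * Xs j w) \+ (fun j => - m * p j) \+
      (fun j => - (p j * (Xs j w - clip M (Xs j w))))); last first.
    by apply/funext => j /=; ring.
  rewrite !seriesD; apply: cvgD; first apply: cvgD => //.
    rewrite -[X in _ --> X]mulr1 (_ : series _ = (fun n => - m * series p n)).
      by apply: cvgMr; exact: weights_series_cvg.
    by apply/funext => n; rewrite /series/= mulr_sumr.
  rewrite (_ : series _ = - series (fun j => p j * (Xs j w - clip M (Xs j w)))).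
    exact: cvgN.
  by apply/funext => n; rewrite /series/= sumrN.
have DB := weighted_series_norm_le wp finD.
(* When [|A w| < e / 2], the rest of the deviation comes from the remainder and the mean shift, both
   controlled by [B w]. *)
have [AL|AL] := leP (e / 2) `|A w|.
  left; right; rewrite /EA /= lee_fin normrX lerXn2r// ?nnegrE//.
  by rewrite divr_ge0// ltW.
right; rewrite /EB /= gee0_abs//; apply: le_trans (leeD2r _ DB).
rewrite -EFinD lee_fin.
set L := limn _ in AE DB *.
have : S w - mu = A w + L + (m - mu) by rewrite AE; ring.
move=> SE; have : `|S w - mu| <= `|A w| + `|L| + `|m - mu|.
  by rewrite SE (le_trans (ler_normD _ _))// lerD2r ler_normD.
rewrite -/mu in eS; move: eS AL mmu; lra.
Qed.

End upper_bound.

(** * Integral bounds by indicators, and the spread of a nonconstant variable *)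

Section integral_bounds.
Context d (T : measurableType d) (R : realType) (Pr : probability T R).

Lemma integral_affine_indic (a b : R) (A : set T) : measurable A ->
  0 <= a -> 0 <= b ->
  (\int[Pr]_w (a + b * \1_A w)%:E = a%:E + b%:E * Pr A)%E.
Proof.
move=> mA a0 b0; under eq_integral do rewrite EFinD EFinM.
rewrite ge0_integralD//; last 2 first.
- by move=> w _; rewrite mule_ge0 ?lee_fin.
- by apply: measurable_funeM; apply/measurable_EFinP; exact: measurable_indic.
rewrite integral_cst// [X in (_ * X + _)%E]probability_setT mule1.
rewrite ge0_integralZl ?lee_fin//; last first.
  by apply/measurable_EFinP; exact: measurable_indic.
by rewrite integral_indic// setIT.
Qed.

Let measurable_affine_indic (a b : R) (A : set T) : measurable A ->
  measurable_fun setT (fun w => (a + b * \1_A w)%:E).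
Proof.
move=> mA; apply/measurable_EFinP; apply: measurable_funD => //.
by apply: measurable_funM => //; exact: measurable_indic.
Qed.

(** Serves to split an expectation over an exceptional event: the bound is [a] off [A] and [a + b]
    on it. *)
Lemma integral_le_affine_indic (f : T -> \bar R) (a b : R) (A : set T) :
  measurable_fun setT f -> (forall w, 0 <= f w)%E -> measurable A ->
  0 <= a -> 0 <= b -> {ae Pr, forall w, (f w <= (a + b * \1_A w)%:E)%E} ->
  (\int[Pr]_w f w <= a%:E + b%:E * Pr A)%E.
Proof.
move=> mf f0 mA a0 b0 fle; rewrite -integral_affine_indic//.
apply: ae_ge0_le_integral => //.
- by move=> w _; rewrite lee_fin addr_ge0// mulr_ge0.
- exact: measurable_affine_indic.
- by apply: filterS fle => w + _.
Qed.

Lemma integral_ge_indic (f : T -> \bar R) (b : R) (A : set T) :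
  measurable_fun setT f -> (forall w, 0 <= f w)%E -> measurable A ->
  0 <= b -> {ae Pr, forall w, A w -> (b%:E <= f w)%E} ->
  (b%:E * Pr A <= \int[Pr]_w f w)%E.
Proof.
move=> mf f0 mA b0 fge; rewrite -[leLHS]add0e -integral_affine_indic//.
apply: ae_ge0_le_integral => //.
- by move=> w _; rewrite lee_fin add0r mulr_ge0.
- exact: measurable_affine_indic.
- apply: filterS fge => w Aw _; rewrite add0r indicE.
  by have [/set_mem/Aw|_] := boolP (w \in A); rewrite ?mulr1// mulr0.
Qed.

(** Otherwise all events [n.+1%:R^-1 <= Y] are null, so [Y <= 0] almost surely; the zero mean then
    forces [|Y|] to have zero integral. *)
Lemma integral0_pos_measure (Y : {RV Pr >-> R}) :
  Pr.-integrable setT (EFin \o Y) -> (\int[Pr]_w (Y w)%:E = 0)%E ->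
  ~ {ae Pr, forall w, Y w = 0} ->
  exists e : R, 0 < e /\ (0 < Pr [set w | e <= Y w]%R)%E.
Proof.
move=> Yint Y0 nY; apply: contrapT => H; apply: nY.
have mYe e : measurable [set w | e <= Y w].
  rewrite (_ : [set w | _] = Y @^-1` `[e, +oo[); first exact: measurable_funPTI.
  by apply/seteqP; split => w /=; rewrite in_itv/= andbT.
have Yle0 : {ae Pr, forall w, Y w <= 0}.
  have : forall n, {ae Pr, forall w, Y w < n.+1%:R^-1}.
    move=> n; exists [set w | n.+1%:R^-1 <= Y w]; split => //.
      apply/eqP; rewrite eq_le measure_ge0 andbT leNgt; apply/negP => P0.
      by apply: H; exists n.+1%:R^-1; rewrite invr_gt0.
    by move=> w /= /negP; rewrite -leNgt.
  move=> /ae_foralln; apply: filterS => w Yw; rewrite leNgt; apply/negP => Yw0.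
  have [n] := ltr_add_invr Yw0; rewrite add0r => nY.
  by have := lt_trans nY (Yw n); rewrite ltxx.
have mY : measurable_fun setT (EFin \o Y) by exact/measurable_EFinP.
have : (\int[Pr]_w `|(EFin \o Y) w| = 0)%E.
  have -> : (\int[Pr]_w `|(EFin \o Y) w| =
             \int[Pr]_w (cst 0 w - (EFin \o Y) w))%E.
    apply: ae_eq_integral => //.
    - exact: measurableT_comp.
    - exact: emeasurable_funB.
    - apply: filterS Yle0 => w Yw _.
      by rewrite /= ler0_norm//; congr EFin; rewrite sub0r.
  by rewrite integralB// ?integral0 ?Y0 ?sube0//; exact: integrable0.
by move=> /(ae_eq_integral_abs _ measurableT mY); apply: filterS => w /(_ I) [].
Qed.

(** [X - mu] and [mu - X] both have mean zero without vanishing almost surely, so [X] charges both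
    sides of its mean at a positive distance. *)
Lemma nonconstant_spread (X : {RV Pr >-> R}) :
  Pr.-integrable setT (EFin \o X) ->
  ~ (exists c : R, {ae Pr, forall w, X w = c}) ->
  exists a b : R, [/\ a < b, (0 < Pr [set w | X w <= a]%R)%E &
    (0 < Pr [set w | b <= X w]%R)%E].
Proof.
move=> Xint nX; pose mu := fine 'E_Pr[X]%E.
have fin : (\int[Pr]_w (X w)%:E)%E \is a fin_num by exact: integrable_fin_num.
have cint : Pr.-integrable setT (EFin \o cst mu).
  exact: (bounded_measurable_integrable Pr (bounded_measurable_cst _ _)).
have EX : (\int[Pr]_w (X w)%:E = mu%:E)%E by rewrite /mu unlock fineK.
have Ec : (\int[Pr]_w (cst mu w)%:E = mu%:E)%E.
  by rewrite /= integral_cst// [X in (_ * X)%E]probability_setT mule1.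
have [|||e1 [e10 P1]] := @integral0_pos_measure (X \- cst mu)%R.
- by rewrite (_ : _ \o _ = (EFin \o X) \- (EFin \o cst mu))%E//; exact: integrableB.
- rewrite (eq_integral (fun w => (X w)%:E - (cst mu w)%:E))%E//.
  by rewrite integralB// EX Ec subee.
- move=> H; apply: nX; exists mu; apply: filterS H => w /eqP.
  by rewrite subr_eq0 => /eqP.
have [|||e2 [e20 P2]] := @integral0_pos_measure (cst mu \- X)%R.
- by rewrite (_ : _ \o _ = (EFin \o cst mu) \- (EFin \o X))%E//; exact: integrableB.
- rewrite (eq_integral (fun w => (cst mu w)%:E - (X w)%:E))%E//.
  by rewrite integralB// EX Ec subee.
- move=> H; apply: nX; exists mu; apply: filterS H => w /eqP.
  by rewrite subr_eq0 => /eqP.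
exists (mu - e2), (mu + e1); split; first lra.
- rewrite (_ : [set w | _] = [set w | e2 <= (cst mu \- X)%R w])//.
  by apply/seteqP; split => w /=; lra.
- rewrite (_ : [set w | _] = [set w | e1 <= (X \- cst mu)%R w])//.
  by apply/seteqP; split => w /=; lra.
Qed.

End integral_bounds.

(** * Convergence to zero of nonnegative extended reals *)

Section convergence_facts.
Context (R : realType) (I : Type) (F : set_system I) {FF : Filter F}.

Lemma ge0_cvge0P (f : I -> \bar R) : (forall t, 0 <= f t)%E ->
  f t @[t --> F] --> 0%E <->
  forall e : R, 0 < e -> \forall t \near F, (f t <= e%:E)%E.
Proof.
move=> f0; split=> [/fine_cvgP[ffin /cvgr0Pnorm_le fe] e e0|fe].
  have := fe e e0; apply: filterS2 ffin => t ft.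
  by rewrite /= ger0_norm ?fine_ge0// -lee_fin fineK.
apply/fine_cvgP; split.
  have := fe 1 ltr01; apply: filterS => t ft.
  by rewrite ge0_fin_numE//; exact: le_lt_trans ft (ltry _).
apply/cvgr0Pnorm_le => e e0; have := fe e e0; apply: filterS => t ft.
rewrite /= ger0_norm ?fine_ge0// -lee_fin fineK//.
by rewrite ge0_fin_numE//; exact: le_lt_trans ft (ltry _).
Qed.

Lemma cvge0_le (f g : I -> \bar R) : (forall t, 0 <= f t)%E ->
  (\forall t \near F, f t <= g t)%E -> g t @[t --> F] --> 0%E ->
  f t @[t --> F] --> 0%E.
Proof.
move=> f0 fg g0; apply: (squeeze_cvge _ (cvg_cst 0%E) g0).
by apply: filterS fg => t ->; rewrite f0.
Qed.

Lemma cvge0Ml (k : R) (f : I -> \bar R) :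
  f t @[t --> F] --> 0%E -> (k%:E * f t)%E @[t --> F] --> 0%E.
Proof. by move=> f0; rewrite -(mule0 k%:E); apply: cvgeZl. Qed.

End convergence_facts.

(** * Convergence to a constant, in distribution and in probability *)

Section convergence_to_constant.
Context d (T : measurableType d) (R : realType) (Pr : probability T R).
Context (I : Type) (F : set_system I) (FF : ProperFilter F).
Variable Y : I -> {RV Pr >-> R}.

Lemma measurable_far (Z : {RV Pr >-> R}) (c e : R) :
  measurable [set w | e < `|Z w - c|].
Proof.
have : measurable_fun setT (fun w => e < `|Z w - c|).
  apply: measurable_fun_ltr => //; apply: measurableT_comp => //.
  exact: measurable_funB.
by move=> /(_ measurableT [set true]); rewrite setTI; exact.
Qed.

Lemma cdf_cst (c x : R) :
  @cdf _ _ _ Pr (cst c : {mfun T >-> R}) x = (c <= x)%R%:R%:E.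
Proof.
rewrite /cdf /distribution /pushforward.
rewrite (_ : _ @^-1` _ = [set w : T | c <= x]); last first.
  by apply/seteqP; split => w /=; rewrite in_itv.
have [cx|xc] := boolP (c <= x).
  by rewrite (_ : [set _ | _] = setT) ?probability_setT//; apply/seteqP.
by rewrite (_ : [set _ | _] = set0) ?measure0//; apply/seteqP; split => // w.
Qed.

Lemma continuous_cdf_cst (c x : R) :
  {for x, continuous (@cdf _ _ _ Pr (cst c : {mfun T >-> R}))} <-> x != c.
Proof.
split=> [cont|].
  apply/eqP => xc; rewrite {x}xc in cont.
  (* At the jump, continuity would make the left limit 1, while the function is 0 to the left of
     [c]. *)
  have h1 : @cdf _ _ _ Pr (cst c : {mfun T >-> R}) y @[y --> c^'-] --> 1%E.
    have := cvg_at_left_filter cont; rewrite cdf_cst lexx; exact.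
  have h0 : @cdf _ _ _ Pr (cst c : {mfun T >-> R}) y @[y --> c^'-] --> 0%E.
    apply: cvg_near_cst; near=> y; rewrite cdf_cst leNgt.
    by have -> : y < c by near: y; exact: nbhs_left_lt.
  have /eqP : 1%E = 0%E :> \bar R by exact: (cvg_unique _ h1 h0).
  by rewrite onee_eq0.
move=> /eqP/eqP xc; rewrite /continuous_at; apply: cvg_near_cst.
have [xlc|] := ltP x c.
  near=> y; rewrite !cdf_cst; congr (_%:R%:E).
  rewrite (leNgt c x) xlc leNgt.
  by have -> : y < c by near: y; exact: lt_nbhsl.
rewrite le_eqVlt eq_sym (negbTE xc)/= => cx.
near=> y; rewrite !cdf_cst (ltW cx) ltW//.
by near: y; exact: lt_nbhsr.
Unshelve. all: by end_near. Qed.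

(** The continuity points of the limit are the points other than [c]. Deviations beyond [e] are
    bounded by the tails at [c - e] and [c + e]; conversely, a tail at [x] lies in a deviation event
    of half the distance from [x] to [c]. *)
Lemma cvg_in_distribution_cstP (c : R) :
  cvg_in_distribution_cst F Y c <-> cvg_in_probability F Y c.
Proof.
split.
  move=> Yc e e0.
  have lo : cdf (Y t) (c - e) @[t --> F] --> 0%E.
    have ce : c - e < c by lra.
    have /continuous_cdf_cst/Yc : c - e != c by rewrite lt_eqF.
    by rewrite cdf_cst leNgt ce.
  have hi : cdf (Y t) (c + e) @[t --> F] --> 1%E.
    have ce : c < c + e by lra.
    have /continuous_cdf_cst/Yc : c + e != c by rewrite gt_eqF.
    by rewrite cdf_cst ltW.
  have hi' : ccdf (Y t) (c + e) @[t --> F] --> 0%E.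
    have -> : (fun t => ccdf (Y t) (c + e)) = (fun t => 1 - cdf (Y t) (c + e))%E.
      by apply/funext => t; rewrite ccdf_1_cdf.
    by rewrite -(@subee _ 1%E)//; apply: cvgeB => //; exact: cvg_cst.
  have : (cdf (Y t) (c - e) + ccdf (Y t) (c + e))%E @[t --> F] --> 0%E.
    by rewrite -[X in _ --> X]adde0; exact: cvgeD.
  apply: cvge0_le => //; apply: nearW => t.
  have mlo : measurable (Y t @^-1` `]-oo, c - e]) by exact: measurable_funPTI.
  have mhi : measurable (Y t @^-1` `]c + e, +oo[) by exact: measurable_funPTI.
  apply: (le_trans _ (measureU2 Pr mlo mhi)).
  apply: le_measure; rewrite ?inE; first exact: measurable_far.
    exact: measurableU.
  move=> w /= H; rewrite !in_itv/= andbT.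
  have [Yl|Yl] := leP (Y t w) (c - e); [by left|right].
  move: H; rewrite ltNge ler_norml negb_and -!ltNge => /orP[]; lra.
move=> Yc x /continuous_cdf_cst xc.
rewrite cdf_cst; have [xlc|] := ltP x c.
  (* Half the distance is taken because deviation events are strict, whereas [Y t w <= x] only gives
     a deviation of at least [c - x]. *)
  have h0 : 0 < (c - x) / 2 by lra.
  change (cdf (Y t) x @[t --> F] --> 0%E).
  have := Yc _ h0; apply: cvge0_le => //; apply: nearW => t.
  rewrite /cdf /distribution /pushforward.
  apply: le_measure; rewrite ?inE; [exact: measurable_funPTI|exact: measurable_far|].
  move=> w /=; rewrite in_itv/= => Yx.
  by rewrite ltr0_norm; lra.
rewrite le_eqVlt eq_sym (negbTE xc)/= => cx.
have -> : (fun t => cdf (Y t) x) = (fun t => 1 - ccdf (Y t) x)%E.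
  by apply/funext => t; rewrite cdf_1_ccdf.
rewrite -[X in _ --> X]sube0; apply: cvgeB => //; first exact: cvg_cst.
have h0 : 0 < (x - c) / 2 by lra.
have := Yc _ h0; apply: cvge0_le => //; apply: nearW => t.
rewrite /ccdf /distribution /pushforward.
apply: le_measure; rewrite ?inE; [exact: measurable_funPTI|exact: measurable_far|].
move=> w /=; rewrite in_itv/= andbT => Yx.
by rewrite gtr0_norm; lra.
Qed.

Lemma cvg_in_probability_near (c e r : R) :
  cvg_in_probability F Y c -> 0 < e -> 0 < r ->
  \forall t \near F, (Pr [set w | e < `|Y t w - c|]%R <= r%:E)%E.
Proof. by move=> Yc e0; move: r; apply/ge0_cvge0P => //; exact: Yc. Qed.

(** No point is within a third of [|c - c'|] of both constants, so the two deviation events cover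
    the space and their probabilities cannot both vanish. *)
Lemma cvg_in_probability_unique (c c' : R) :
  cvg_in_probability F Y c -> cvg_in_probability F Y c' -> c = c'.
Proof.
move=> Yc Yc'; apply/eqP; apply: contrapT => /negP cc'.
have h0 : 0 < `|c - c'| / 3 by rewrite divr_gt0// normr_gt0 subr_eq0.
have : (cst 1%E : I -> \bar R) t @[t --> F] --> 0%E.
  have : (Pr [set w | (`|c - c'| / 3 < `|Y t w - c|)%R] +
          Pr [set w | (`|c - c'| / 3 < `|Y t w - c'|)%R])%E @[t --> F] --> 0%E.
    by rewrite -[X in _ --> X]adde0; apply: cvgeD => //; [exact: Yc|exact: Yc'].
  apply: cvge0_le => //; apply: nearW => t /=.
  apply: (le_trans _ (measureU2 Pr (measurable_far _ _ _) (measurable_far _ _ _))).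
  rewrite -(probability_setT Pr); apply: le_measure; rewrite ?inE//.
    by apply: measurableU; exact: measurable_far.
  move=> w _ /=; set D := `|c - c'| / 3.
  have [Yl|Yl] := ltP D `|Y t w - c|; [by left|right].
  have : `|c - c'| <= `|Y t w - c| + `|Y t w - c'|.
    rewrite (distrC _ c) (_ : c - c' = (c - Y t w) + (Y t w - c')); last by ring.
    exact: ler_normD.
  by move: h0 Yl; rewrite /D; lra.
move=> h1.
have /eqP : 0%E = 1%E :> \bar R.
  exact: (cvg_unique _ h1 (cvg_cst 1%E)).
by rewrite eq_sym onee_eq0.
Qed.

End convergence_to_constant.

(** * Integrating the fixed-weight bounds over the random weights *)

Section random_weights.
Context d (T : measurableType d) (R : realType) (Pr : probability T R).
Variables (P : nat -> {RV Pr >-> R}) (X : {RV Pr >-> R}) (Xs : nat -> {RV Pr >-> R}).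
Hypotheses (iidX : iid (oapp Xs X)) (X_int : Pr.-integrable setT (EFin \o X)).
Hypothesis PX : independent_families (oapp Xs X) P.
Hypothesis wP : {ae Pr, forall w, is_weights (P ^~ w)}.

Let S : {RV Pr >-> R} := weighted_sum P Xs.
Let Pmax : {RV Pr >-> R} := max_weight P.

Let freeze (w : T) : {RV Pr >-> R} :=
  weighted_sum (fun j => cst (P j w) : {mfun T >-> R}) Xs.

(** The deviation event is a measurable set of pairs of sequences, one of weights and one of
    summands, so independence allows freezing the weights. *)
Lemma weighted_sum_disintegration (c e : R) :
  let F w := Pr [set w' | e < `|freeze w w' - c|] in
  measurable_fun setT F /\
  Pr [set w | e < `|S w - c|] = (\int[Pr]_w F w)%E.
Proof.
pose SS := (sequence_space R * sequence_space R)%type.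
have m1 j : measurable_fun setT (fun z : SS => z.1 j).
  exact: measurableT_comp (measurable_coordinate j) (@measurable_fst _ _ _ _).
have m2 j : measurable_fun setT (fun z : SS => z.2 j).
  exact: measurableT_comp (measurable_coordinate j) (@measurable_snd _ _ _ _).
pose f1 j : {mfun SS >-> R} :=
  HB.pack (fun z : SS => z.1 j) (isMeasurableFun.Build _ _ _ _ _ (m1 j)).
pose f2 j : {mfun SS >-> R} :=
  HB.pack (fun z : SS => z.2 j) (isMeasurableFun.Build _ _ _ _ _ (m2 j)).
pose Z := weighted_sum f1 f2.
have mB : measurable [set z | e < `|Z z - c|].
  have : measurable_fun setT (fun z => e < `|Z z - c|).
    apply: measurable_fun_ltr => //; apply: measurableT_comp => //.
    by apply: measurable_funB => //; exact: measurable_weighted_sum.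
  by move=> /(_ measurableT [set true]); rewrite setTI; exact.
(* The index map [Some] selects the summands [Xs] from the family extended by [X]. *)
exact: (@independent_families_disintegration _ _ _ _ _ _ Some _ _ PX mB).
Qed.

Lemma Pmax_far_measurable (e : R) : measurable [set w | e < `|Pmax w - 0|].
Proof. exact: measurable_far. Qed.

(** When the maximal weight exceeds [e], some weight [J] does too, and the threshold
    [e * (b - a) / 2] is the one that the fixed-weight lower bound then admits. *)
Lemma max_weight_lower_bound (a b c e : R) : a < b ->
  (Pr [set w | X w <= a]%R * Pr [set w | b <= X w]%R *
     Pr [set w | e < `|Pmax w - 0|]%R <=
   2%:E * Pr [set w | e * (b - a) / 2 < `|S w - c|]%R)%E.
Proof.
move=> ab; have [mF ->] := weighted_sum_disintegration c (e * (b - a) / 2).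
set q := (Pr _ * Pr _)%E.
have q0 : (0 <= q)%E by rewrite mule_ge0.
have qfin : q \is a fin_num.
  rewrite fin_numM// fin_num_measure//.
    by rewrite (_ : [set w | _] = X @^-1` `]-oo, a]);
      [exact: measurable_funPTI|apply/seteqP; split => w /=; rewrite in_itv].
  by rewrite (_ : [set w | _] = X @^-1` `[b, +oo[);
    [exact: measurable_funPTI|apply/seteqP; split => w /=; rewrite in_itv/= andbT].
rewrite -ge0_integralZl//.
rewrite -(fineK qfin); apply: integral_ge_indic => //.
- exact: measurable_funeM.
- by move=> w; rewrite mule_ge0.
- exact: Pmax_far_measurable.
- exact: fine_ge0.
apply: filterS wP => w ww /=; rewrite subr0 ger0_norm; last first.
  exact: weights_sup_ge0 ww.
move=> /(weights_lt_sup ww)[J eJ]; rewrite fineK//.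
apply: (fixed_weights_lower_bound iidX X_int c ww (J := J)) => //.
by rewrite mulrCA divff// mulr1 ltr_pM2r// subr_gt0.
Qed.

(** The fixed-weight bound grows linearly with the maximal weight, which is at most 1 always and at
    most [dlt] off the exceptional event. *)
Lemma weighted_sum_upper_bound (M e dlt : R)
    (K := 16 * M ^+ 2 / e ^+ 2) : 0 <= M -> 0 < e -> 0 <= dlt ->
  (Pr [set w | e < `|S w - fine 'E_Pr[X]%E|]%R <=
   (K * dlt + 4 / e * clip_error X M)%:E +
   K%:E * Pr [set w | dlt < `|Pmax w - 0|]%R)%E.
Proof.
move=> M0 e0 d0.
have K0 : 0 <= K by apply: divr_ge0; [apply: mulr_ge0 => //|]; exact: sqr_ge0.
have [mF ->] := weighted_sum_disintegration (fine 'E_Pr[X]%E) e.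
apply: integral_le_affine_indic => //.
- exact: Pmax_far_measurable.
- apply: addr_ge0; apply: mulr_ge0 => //; last exact: clip_error_ge0.
  by apply: divr_ge0 => //; exact: ltW.
apply: filterS wP => w ww.
apply: le_trans (fixed_weights_upper_bound iidX X_int ww M0 e0) _.
rewrite lee_fin -/K addrAC lerD2r -mulrDr ler_wpM2l//.
have m0 := weights_sup_ge0 ww.
rewrite indicE; have [|] := boolP (w \in _).
  by move=> _; rewrite (le_trans (weights_sup_le1 ww))// lerDr.
rewrite notin_setE /= subr0 ger0_norm// => /negP; rewrite -leNgt addr0; exact.
Qed.

Let powsum (p : R) w := (\sum_(j <oo) (P j w `^ p)%:E)%E.

Let powsum_ge0 p w : (0 <= powsum p w)%E.
Proof. by apply: nneseries_ge0 => j _ _; rewrite lee_fin powR_ge0. Qed.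

Let measurable_powsum p : measurable_fun setT (powsum p).
Proof.
apply: ge0_emeasurable_sum => j.
  by move=> w _ _; rewrite lee_fin powR_ge0.
move=> _; apply/measurable_EFinP.
exact: (measurableT_comp (measurable_powR p) (measurable_funPT (P j))).
Qed.

(** The power sum is at most the maximal weight to the power [p - 1], hence at most 1 in general and
    at most [dlt] to that power off the exceptional event. *)
Lemma moment_upper_bound (p dlt : R) : 1 < p -> 0 <= dlt ->
  (\int[Pr]_w powsum p w <=
   (dlt `^ (p - 1))%:E + 1%:E * Pr [set w | dlt < `|Pmax w - 0|]%R)%E.
Proof.
move=> p1 d0; apply: integral_le_affine_indic => //.
- exact: Pmax_far_measurable.
- exact: powR_ge0.
apply: filterS wP => w ww; have [w0 w1] := ww.
have p10 : 0 <= p - 1 by lra.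
set m := sup (range (P ^~ w)).
have m0 : 0 <= m := weights_sup_ge0 ww.
apply: (@le_trans _ _ (\sum_(j <oo) ((m `^ (p - 1))%:E * (P j w)%:E))%E).
  apply: lee_nneseries => [j _ _|j _]; first by rewrite lee_fin powR_ge0.
  rewrite -EFinM lee_fin.
  have -> : P j w `^ p = P j w `^ (p - 1) * P j w.
    have [->|Pj0] := eqVneq (P j w) 0.
      by rewrite mulr0 powR0// gt_eqF// (lt_trans ltr01).
    rewrite -{3}[P j w]powRr1// -powRD ?subrK// Pj0 implybT//.
  rewrite ler_wpM2r//; apply: ge0_ler_powR => //; rewrite ?nnegrE//.
  exact: weights_le_sup ww.
rewrite nneseriesZl; last by move=> j _; rewrite lee_fin.
rewrite w1 mule1 lee_fin mul1r indicE.
have [|] := boolP (w \in _).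
  move=> _; apply: (@le_trans _ _ 1); last by rewrite lerDr powR_ge0.
  apply: (@le_trans _ _ (1 `^ (p - 1))); last by rewrite powR1.
  by apply: ge0_ler_powR => //; rewrite ?nnegrE//; exact: weights_sup_le1.
rewrite notin_setE /= subr0 ger0_norm// => /negP; rewrite -leNgt addr0 => md.
by apply: ge0_ler_powR => //; rewrite ?nnegrE.
Qed.

(** Markov's inequality: on the event some weight exceeds [e], and its power alone bounds the sum
    from below. *)
Lemma moment_lower_bound (p e : R) : 0 <= p -> 0 <= e ->
  ((e `^ p)%:E * Pr [set w | e < `|Pmax w - 0|]%R <= \int[Pr]_w powsum p w)%E.
Proof.
move=> p0 e0; apply: integral_ge_indic => //.
- exact: Pmax_far_measurable.
- exact: powR_ge0.
apply: filterS wP => w ww /=; rewrite subr0 ger0_norm; last first.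
  exact: weights_sup_ge0 ww.
move=> /(weights_lt_sup ww)[J eJ].
apply: (@le_trans _ _ (P J w `^ p)%:E).
  rewrite lee_fin; apply: ge0_ler_powR => //; rewrite ?nnegrE//; last exact: ltW.
  exact: ww.1.
rewrite /powsum (@nneseriesD1 _ _ J)//; last by move=> k _; rewrite lee_fin powR_ge0.
by rewrite leeDl// nneseries_ge0// => k _ _; rewrite lee_fin powR_ge0.
Qed.

End random_weights.

(** * The equivalences and the identification of the limit *)

Theorem theorem2p3 (R : realType) (d : measure_display)
    (T : measurableType d) (Pr : probability T R)
    (star : set_system R) (star_def : star = 0^'+ \/ star = pinfty_nbhs R)
    (P : R -> nat -> {RV Pr >-> R})
    (X : {RV Pr >-> R}) (Xs : nat -> {RV Pr >-> R})
    (X_iid : iid (oapp Xs X))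
    (X_indep : forall t : R, 0 < t -> independent_families (oapp Xs X) (P t))
    (X_int : Pr.-integrable setT (EFin \o X))
    (X_noncst : ~ exists c : R, {ae Pr, forall w, X w = c})
    (P_ge0 : forall t : R, 0 < t -> {ae Pr, forall w, forall j, 0 <= P t j w})
    (P_sum1 : forall t : R, 0 < t ->
      {ae Pr, forall w, (\sum_(j <oo) (P t j w)%:E = 1)%E}) :
  let S t : {RV Pr >-> R} := weighted_sum (P t) Xs in
  let Pstar t : {RV Pr >-> R} := max_weight (P t) in
  let mu : R := fine 'E_Pr[X] in
  let moment_cvg0 (p : R) :=
    (\int[Pr]_w \sum_(j <oo) (P t j w `^ p)%:E)%E @[t --> star] --> 0%E in
  [<-> exists c : R, cvg_in_distribution_cst star S c;
       cvg_in_probability star Pstar 0;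
       exists p : R, 1 < p /\ moment_cvg0 p;
       forall p : R, 1 < p -> moment_cvg0 p] /\
  ((exists c : R, cvg_in_distribution_cst star S c) ->
     (forall c : R, cvg_in_distribution_cst star S c -> c = mu) /\
     cvg_in_probability star S mu).
Proof.
move=> S Pstar mu moment_cvg0.
have FF : ProperFilter star by case: star_def => ->; exact: _.
(* The hypotheses concern positive [t] only; such [t] are eventual for both choices of [star]. *)
have t_gt0 : star [set t : R | 0 < t].
  case: star_def => ->; first exact: nbhs_right_gt.
  exact: nbhs_pinfty_gt.
have wP (t : R) : 0 < t -> {ae Pr, forall w, is_weights (P t ^~ w)}.
  by move=> t0; move: (P_ge0 t t0) (P_sum1 t t0); apply: filterS2 => w ? ?; split.
have moment_ge0 p t : (0 <= \int[Pr]_w \sum_(j <oo) (P t j w `^ p)%:E)%E.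
  apply: integral_ge0 => w _; apply: nneseries_ge0 => j _ _.
  by rewrite lee_fin powR_ge0.
have max_to_moment p : 1 < p -> cvg_in_probability star Pstar 0 -> moment_cvg0 p.
  move=> p1 P0; apply/ge0_cvge0P => // e e0.
  have p10 : 0 < p - 1 by rewrite subr_gt0.
  (* Chosen so that its power [p - 1] equals [e / 2]. *)
  pose dlt := (e / 2) `^ (p - 1)^-1.
  have dE : dlt `^ (p - 1) = e / 2.
    by rewrite -powRrM mulVf ?gt_eqF// powRr1// ltW// divr_gt0.
  have d0 : 0 < dlt by rewrite powR_gt0// divr_gt0.
  have e20 : 0 < e / 2 by rewrite divr_gt0.
  move: t_gt0 (cvg_in_probability_near FF P0 d0 e20); apply: filterS2 => t t0 Pt.
  apply: le_trans (moment_upper_bound (wP t t0) p1 (ltW d0)) _.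
  by rewrite dE mul1e [in leRHS](splitr e) EFinD leeD2l.
have moment_to_max p : 1 < p -> moment_cvg0 p -> cvg_in_probability star Pstar 0.
  move=> p1 mp e e0.
  apply: (cvge0_le _ _ (cvge0Ml ((e `^ p)^-1) mp)) => //; apply: filterS t_gt0 => t t0.
  have ep0 : 0 < e `^ p by rewrite powR_gt0.
  rewrite -(@lee_pmul2l _ (e `^ p)%:E)// muleA -EFinM divff ?gt_eqF// mul1e.
  apply: (moment_lower_bound (wP t t0) _ (ltW e0)).
  exact: le_trans (ltW p1).
have max_to_sum : cvg_in_probability star Pstar 0 -> cvg_in_probability star S mu.
  move=> P0 e e0; apply/ge0_cvge0P => // r r0.
  (* The clipping level comes first, to make the remainder at most [r / 2]; only then is [dlt]
     chosen, in terms of the resulting constant [K]. *)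
  have [M M0 clipM] : exists2 M, 0 <= M & 4 / e * clip_error X M <= r / 2.
    have h0 : 0 < r / 2 / (4 / e) by rewrite !divr_gt0.
    have /cvgr0Pnorm_le/(_ _ h0)[n _ /(_ n (leqnn n))] := clip_error_cvg0 X_int.
    rewrite /= ger0_norm ?clip_error_ge0// ler_pdivlMr ?divr_gt0// mulrC => H.
    by exists n%:R.
  pose K := 16 * M ^+ 2 / e ^+ 2.
  have K0 : 0 <= K.
    by apply: divr_ge0; [apply: mulr_ge0 => //|]; exact: sqr_ge0.
  (* [dlt] bounds both the maximal weight and the probability of the exceptional event; each costs
     [K * dlt <= r / 4]. The denominator [K + 1] stays positive when [K] is 0. *)
  pose dlt := r / 4 / (K + 1).
  have K10 : 0 < K + 1 by lra.
  have d0 : 0 < dlt by rewrite !divr_gt0.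
  have Kd : K * dlt <= r / 4.
    by rewrite /dlt mulrA ler_pdivrMr// mulrC ler_wpM2l//; lra.
  move: t_gt0 (cvg_in_probability_near FF P0 d0 d0); apply: filterS2 => t t0 Pt.
  apply: le_trans (weighted_sum_upper_bound X_iid X_int (X_indep t t0) (wP t t0)
    M0 e0 (ltW d0)) _.
  apply: (@le_trans _ _ ((K * dlt + 4 / e * clip_error X M)%:E + K%:E * dlt%:E)%E).
    by rewrite leeD2l// lee_wpmul2l.
  by rewrite -EFinM -EFinD lee_fin; lra.
have dist_to_max c : cvg_in_distribution_cst star S c ->
    cvg_in_probability star Pstar 0.
  move=> /cvg_in_distribution_cstP Sc e e0.
  have [a [b [ab Pa Pb]]] := nonconstant_spread X_int X_noncst.
  set q := (Pr [set w | X w <= a]%R * Pr [set w | b <= X w]%R)%E.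
  have q0 : (0 < q)%E by rewrite mule_gt0.
  have q1 : (q <= 1)%E.
    rewrite -[leRHS]mule1 lee_pmul// probability_le1//.
      rewrite (_ : [set w | _] = X @^-1` `]-oo, a]); first exact: measurable_funPTI.
      by apply/seteqP; split => w /=; rewrite in_itv.
    rewrite (_ : [set w | _] = X @^-1` `[b, +oo[); first exact: measurable_funPTI.
    by apply/seteqP; split => w /=; rewrite in_itv/= andbT.
  have qfin : q \is a fin_num.
    by rewrite ge0_fin_numE ?ltW//; exact: le_lt_trans q1 (ltry _).
  have q'0 : 0 < fine q by rewrite fine_gt0// q0 -ge0_fin_numE// ltW.
  have e'0 : 0 < e * (b - a) / 2 by rewrite divr_gt0// mulr_gt0// subr_gt0.
  (* Dividing the lower bound by the positive finite [q] dominates the tail of the maximal weight by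
     that of the sum. *)
  apply: (cvge0_le _ _ (cvge0Ml ((fine q)^-1 * 2) (Sc _ e'0))) => //; apply: filterS t_gt0 => t t0.
  rewrite -(@lee_pmul2l _ (fine q)%:E)// muleA -EFinM mulrA divff ?gt_eqF// mul1r.
  rewrite fineK//.
  exact: (max_weight_lower_bound X_iid X_int (X_indep t t0) (wP t t0) c e ab).
split.
  tfae.
  - by case=> c; exact: dist_to_max.
  - by move=> P0; exists 2; split; [lra|apply: max_to_moment => //; lra].
  - by case=> p [p1 mp] q q1; apply: max_to_moment => //; exact: moment_to_max mp.
  (* The exponent 2 suffices to return to the maximal weight and close the cycle, with [mu] as the
     limit. *)
  - move=> /(_ 2) m2; exists mu; apply/cvg_in_distribution_cstP.
    by apply: max_to_sum; apply: (@moment_to_max 2); [lra|apply: m2; lra].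
case=> c Sc; have Smu := max_to_sum (dist_to_max c Sc).
split=> // c' /cvg_in_distribution_cstP Sc'.
exact: (cvg_in_probability_unique FF Sc' Smu).
Qed.
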